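(* There exist universal constants $C,K\geqslant 1$ for which both of the following hold, for every measure $\mu$ on a set $D$ and every integer $n\geqslant 1$, with $L^2=L^2(D,\mu)$. (a) For every $n$-dimensional linear subspace $V_n\subset L^2$ there exist a random sample $X=\{x^1,\dots,x^m\}\in D^m$ with $m\leqslant Cn$ and a map $R:D^m\times\mathbb C^m\to V_n$ such that for every $u\in L^2$, $\mathbb E_X\left(\|u-R(x^1,\dots,x^m,u(x^1),\dots,u(x^m))\|^2\right)\leqslant K\min_{v\in V_n}\|u-v\|^2$. (b) For every compact set $\mathcal K\subset L^2$, $$\rho^{\rm rand}_{Cn}(\mathcal K)_{L^2}\leqslant K\,d_n(\mathcal K)_{L^2}.$$
   Context: Functions are complex valued, and $\|v\|:=\|v\|_{L^2}=\left(\int_D|v|^2\,d\mu\right)^{1/2}$. A random sample is a random element $X=\{x^1,\dots,x^m\}$ of $D^m$ (points may be repeated, and need not be independent), with expectation denoted $\mathbb E_X$ or $\mathbb E$. Its law does not depend on $u$. Values $u(x^i)$ are those of an arbitrary representative of $u\in L^2$; the reconstruction is required to be almost surely independent of this choice. Kolmogorov $n$-width: $d_n(\mathcal K)_{L^2}:=\inf_{\dim V_n=n}\ \sup_{u\in\mathcal K}\ \inf_{v\in V_n}\|u-v\|$, where the first infimum is over all linear subspaces $V_n\subset L^2$ of dimension $n$. Randomized (linear) sampling numbers: $\rho^{\rm rand}_m(\mathcal K)_{L^2}\geqslant 0$ is defined by $$\rho^{\rm rand}_m(\mathcal K)_{L^2}^2:=\inf_{X,R_X}\ \sup_{u\in\mathcal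 K}\ \mathbb E\left(\|u-R_X(u(x^1),\dots,u(x^m))\|^2\right),$$ where the infimum is over all random variables $X=\{x^1,\dots,x^m\}\in D^m$ and all linear reconstruction maps $R_X:\mathbb C^m\to L^2$ (which may depend on the drawn sample $X$). The index $Cn$ is understood as its integer part $\lfloor Cn\rfloor$. *)

(* Defs.v *)
From HB Require Import structures.
From mathcomp Require Import all_boot all_order all_algebra.
From mathcomp Require Import generic_quotient ring_quotient.
From mathcomp.real_closed Require Import complex.
From mathcomp Require Import all_classical all_reals all_analysis.
From mathcomp Require Import measurable_realfun.

Set Implicit Arguments.
Unset Strict Implicit.
Unset Printing Implicit Defensive.
Import Order.TTheory GRing.Theory Num.Theory.
Import numFieldNormedType.Exports.
Import Quotient.Exports.

Local Open Scope classical_set_scope.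
Local Open Scope quotient_scope.
Local Open Scope ring_scope.

Section square_integrable.
Context {d} {D : measurableType d} {R : realType}.
Variable mu : {measure set D -> \bar R}.
Implicit Types (f g : D -> R[i]) (c : R[i]).

Definition cmeasurable f :=
  measurable_fun [set: D] (fun x => complex.Re (f x)) /\
  measurable_fun [set: D] (fun x => complex.Im (f x)).

Definition L2norm f : \bar R := 'N[mu]_2%:E[EFin \o (fun x => Normc.normc (f x))]%E.

Definition L2pred : {pred D -> R[i]} :=
  mem [set f | cmeasurable f /\ (L2norm f < +oo)%E].

Lemma L2predP f : reflect (cmeasurable f /\ (L2norm f < +oo)%E) (f \in L2pred).
Proof. by apply: (iffP idP); rewrite inE. Qed.

Lemma L2norm_ge0 f : (0 <= L2norm f)%E. Proof. exact: Lnorm_ge0. Qed.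

Lemma L2norm_sqr f :
  (L2norm f ^+ 2 = \int[mu]_x ((Normc.normc (f x)) ^+ 2)%:E)%E.
Proof.
have -> : (L2norm f ^+ 2 = L2norm f `^ 2)%E.
  case: (L2norm f) (L2norm_ge0 f) => [r r0||//]; last first.
    by rewrite expe2 mulyy poweRyr.
  by rewrite poweR_EFin powR_mulrn.
rewrite poweR_Lnorm//; apply: eq_integral => x _; rewrite /= powR_mulrn//.
by rewrite real_normK// num_real.
Qed.

Lemma normc_ge0 (z : R[i]) : 0 <= Normc.normc z.
Proof. by case: z => a b; exact: sqrtr_ge0. Qed.

Lemma cmeasurable_normc f :
  cmeasurable f -> measurable_fun [set: D] (fun x => Normc.normc (f x)).
Proof.
move=> [mr mi]; rewrite (_ : (fun _ => _) =
  Num.sqrt \o (fun x => complex.Re (f x) ^+ 2 + complex.Im (f x) ^+ 2)).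
  apply: measurableT_comp; last by apply: measurable_funD; exact: measurable_funX.
  by apply: continuous_measurable_fun; exact: sqrt_continuous.
by apply/funext => x /=; case: (f x).
Qed.

Lemma cmeasurableD f g : cmeasurable f -> cmeasurable g -> cmeasurable (f + g).
Proof.
move=> [fr fi] [gr gi]; split.
  rewrite (_ : (fun _ => _) = (fun x => complex.Re (f x) + complex.Re (g x))).
    exact: measurable_funD.
  by apply/funext => x; rewrite /GRing.add/=; case: (f x) (g x) => [? ?] [? ?].
rewrite (_ : (fun _ => _) = (fun x => complex.Im (f x) + complex.Im (g x))).
  exact: measurable_funD.
by apply/funext => x; rewrite /GRing.add/=; case: (f x) (g x) => [? ?] [? ?].
Qed.

Lemma cmeasurableZ c f : cmeasurable f -> cmeasurable (c *: f).
Proof.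
case: c => a b [fr fi]; split.
  rewrite (_ : (fun _ => _) =
    (fun x => a * complex.Re (f x) - b * complex.Im (f x))).
    by apply: measurable_funB; exact: measurable_funM.
  by apply/funext => x; rewrite /GRing.scale/=; case: (f x) => [? ?].
rewrite (_ : (fun _ => _) =
    (fun x => a * complex.Im (f x) + b * complex.Re (f x))).
  by apply: measurable_funD; exact: measurable_funM.
by apply/funext => x; rewrite /GRing.scale/=; case: (f x) => [? ?].
Qed.

Lemma L2norm0 : L2norm 0 = 0%E.
Proof.
rewrite /L2norm (_ : _ \o _ = cst 0%E) ?Lnorm0//.
by apply/funext => x; congr EFin; exact: Normc.normc0.
Qed.

Lemma L2normZ c f : cmeasurable f ->
  L2norm (c *: f) = ((Normc.normc c)%:E * L2norm f)%E.
Proof.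
move=> /cmeasurable_normc mf.
rewrite /L2norm (_ : _ \o _ =
  (fun x => (Normc.normc c)%:E * (Normc.normc (f x))%:E)%E); last first.
  by apply/funext => x; rewrite -EFinM -Normc.normcM.
rewrite unlock; under eq_integral do rewrite abseM poweRM//.
rewrite /= ge0_integralZl//=; last first.
  apply/measurable_EFinP; apply: (measurableT_comp (measurable_powR _)).
  exact: measurableT_comp.
rewrite poweRM ?lee_fin ?powR_ge0//; last first.
  by apply: integral_ge0 => x _; rewrite lee_fin powR_ge0.
congr (_ * _)%E; rewrite poweR_EFin -powRrM divff// powRr1//.
by rewrite ger0_norm ?normc_ge0.
Qed.

Lemma L2normD f g : cmeasurable f -> cmeasurable g ->
  (L2norm (f + g)%R <= L2norm f + L2norm g)%E.
Proof.
move=> mf mg; pose h x := Normc.normc (f x) + Normc.normc (g x).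
have mfg := cmeasurable_normc (cmeasurableD mf mg).
apply: (@le_trans _ _ ('N[mu]_2%:E[EFin \o h])%E).
  rewrite /L2norm unlock gt0_ler_poweR ?in_itv/= ?leey ?andbT//.
  - by apply: integral_ge0 => x _; rewrite lee_fin powR_ge0.
  - by apply: integral_ge0 => x _; rewrite lee_fin powR_ge0.
  apply: ge0_le_integral => //=.
  - apply/measurable_EFinP; apply: (measurableT_comp (measurable_powR _)).
    exact: measurableT_comp.
  - apply/measurable_EFinP; apply: (measurableT_comp (measurable_powR _)).
    apply: measurableT_comp => //.
    by apply: measurable_funD; exact: cmeasurable_normc.
  move=> x _; rewrite lee_fin.
  have h0 : 0 <= h x by rewrite addr_ge0 ?normc_ge0.
  rewrite ge0_ler_powR ?nnegrE// !ger0_norm ?normc_ge0//.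
  exact: le_normcD.
by apply: minkowski_EFin; rewrite ?ler1n//; exact: cmeasurable_normc.
Qed.

Lemma L2norm_eq0 f : cmeasurable f -> L2norm f = 0%E <-> f = 0 %[ae mu].
Proof.
move=> mf; have mn := cmeasurable_normc mf; split=> [f0|f0].
  have : EFin \o (fun x => Normc.normc (f x)) = \0%E %[ae mu].
    by apply: Lnorm_eq0_eq0 f0; [exact/measurable_EFinP|rewrite lte_fin].
  by apply: filterS => x /= /[apply] -[/Normc.eq0_normc].
rewrite /L2norm unlock (@ae_eq_integral _ _ _ mu [set: D] (cst 0%E))//=.
- by rewrite integral0 poweR0r// invr_neq0.
- apply/measurable_EFinP; apply: (measurableT_comp (measurable_powR _)).
  exact: measurableT_comp.
- apply: filterS f0 => x /= /[apply] ->.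
  by rewrite Normc.normc0 normr0 powR0.
Qed.

Lemma L2pred_submod_closed : submod_closed L2pred.
Proof.
split.
  apply/L2predP; split; last by rewrite L2norm0.
  by split; rewrite (_ : (fun _ => _) = cst 0).
move=> c f g /L2predP[mf lf] /L2predP[mg lg]; apply/L2predP; split.
  by apply: cmeasurableD => //; exact: cmeasurableZ.
apply: (le_lt_trans (L2normD _ _)) => //; first exact: cmeasurableZ.
by rewrite lte_add_pinfty// L2normZ// lte_mul_pinfty// lee_fin normc_ge0.
Qed.

HB.instance Definition _ := GRing.isSubmodClosed.Build _ _ L2pred
  L2pred_submod_closed.

(* L2fun is the space of square-integrable functions themselves; the quotient
   by almost everywhere equality is L2 below, and a representative of u : L2 is
   any f : L2fun with L2class f = u. *)
Record L2fun := MkL2fun { L2val :> D -> R[i]; L2valP : L2val \in L2pred }.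

HB.instance Definition _ := [isSub for L2val].
HB.instance Definition _ := [Choice of L2fun by <:].
HB.instance Definition _ := [SubChoice_isSubLmodule of L2fun by <:].

End square_integrable.

Section L2_space.
Context {d} {D : measurableType d} {R : realType}.
Variable mu : {measure set D -> \bar R}.
Local Notation calL2 := (L2fun mu).
Implicit Types (f g : calL2) (c : R[i]).

Lemma L2fun_cmeasurable f : cmeasurable f.
Proof. by case: f => f /= /L2predP[]. Qed.

Lemma L2fun_fin f : (L2norm mu f < +oo)%E.
Proof. by case: f => f /= /L2predP[]. Qed.

Definition L2null : {pred calL2} := mem [set f : calL2 | f = 0 %[ae mu]].

Lemma L2nullP f : reflect (f = 0 %[ae mu]) (f \in L2null).
Proof. by apply: (iffP idP); rewrite inE. Qed.

Lemma L2null_zmod_closed : zmod_closed L2null.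
Proof.
split; first by apply/L2nullP; exact: aeW.
move=> f g /L2nullP f0 /L2nullP g0; apply/L2nullP.
by apply: filterS2 f0 g0 => x /= fx gx xT;
  rewrite -[LHS]/(f x - g x) fx// gx// subrr.
Qed.

HB.instance Definition _ := GRing.isZmodClosed.Build _ L2null L2null_zmod_closed.

Definition L2 : Type := Quotient.quot [the zmodClosed calL2 of L2null].

HB.instance Definition _ := Choice.on L2.
HB.instance Definition _ := EqQuotient.on L2.
HB.instance Definition _ := GRing.Zmodule.on L2.

Definition L2class : calL2 -> L2 := \pi_L2.

Lemma L2classE f g : L2class f = L2class g <-> f = g %[ae mu].
Proof.
split.
  move/eqP; rewrite -Quotient.idealrBE => /L2nullP; apply: filterS => x /= fg xT.
  by apply/eqP; rewrite -subr_eq0; apply/eqP; exact: fg.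
move=> fg; apply/eqP; rewrite -Quotient.idealrBE; apply/L2nullP.
by apply: filterS fg => x /= fg xT; rewrite -[LHS]/(f x - g x) fg// subrr.
Qed.


Lemma L2classD f g : L2class (f + g) = L2class f + L2class g.
Proof. exact: Quotient.pi_add. Qed.

Lemma L2class0 : L2class 0 = 0.
Proof. by rewrite /L2class piE. Qed.

Lemma L2class_repr (u : L2) : L2class (repr u) = u.
Proof. exact: reprK. Qed.

Lemma L2class_ind (P : L2 -> Prop) :
  (forall f, P (L2class f)) -> forall u, P u.
Proof. by move=> Pf u; rewrite -(L2class_repr u). Qed.

Definition L2scale c (u : L2) : L2 := L2class (c *: repr u).

Lemma L2classZ c f : L2class (c *: f) = L2scale c (L2class f).
Proof.
apply/L2classE; have /L2classE := L2class_repr (L2class f).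
by apply: filterS => x /= /[apply] fx;
  rewrite -[LHS]/(c * f x) -fx.
Qed.

Let L2scaleA a b (u : L2) : L2scale a (L2scale b u) = L2scale (a * b) u.
Proof. by elim/L2class_ind: u => f; rewrite -!L2classZ scalerA. Qed.

Let L2scale1 : left_id 1 L2scale.
Proof. by elim/L2class_ind => f; rewrite -L2classZ scale1r. Qed.

Let L2scaleDr : right_distributive L2scale +%R.
Proof.
move=> c; elim/L2class_ind => f; elim/L2class_ind => g.
by rewrite -L2classD -!L2classZ scalerDr L2classD.
Qed.

Let L2scaleDl (u : L2) : {morph L2scale^~ u : a b / a + b}.
Proof.
by move=> a b; elim/L2class_ind: u => f; rewrite -!L2classZ scalerDl L2classD.
Qed.

HB.instance Definition _ := GRing.Zmodule_isLmodule.Build R[i] L2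
  L2scaleA L2scale1 L2scaleDr L2scaleDl.

Definition L2normr (u : L2) : R := fine (L2norm mu (repr u)).

Lemma L2normrE f : (L2normr (L2class f))%:E = L2norm mu f.
Proof.
rewrite fineK ?ge0_fin_numE ?L2norm_ge0 ?L2fun_fin//.
have le (g h : calL2) : g = h %[ae mu] -> (L2norm mu g <= L2norm mu h)%E.
  move=> /L2classE/eqP; rewrite -Quotient.idealrBE => /L2nullP.
  move=> /(L2norm_eq0 mu (L2fun_cmeasurable _)) gh.
  rewrite -[leRHS]add0e -gh -{1}(subrK h g).
  by apply: L2normD; exact: L2fun_cmeasurable.
have /L2classE E := L2class_repr (L2class f).
by apply/eqP; rewrite eq_le !le// ; exact: ae_eq_sym.
Qed.

Let L2normr_triangle (u v : L2) : L2normr (u + v) <= L2normr u + L2normr v.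
Proof.
elim/L2class_ind: u => f; elim/L2class_ind: v => g.
rewrite -L2classD -lee_fin EFinD !L2normrE.
by apply: L2normD; exact: L2fun_cmeasurable.
Qed.

Lemma L2normrZ c (u : L2) : L2normr (c *: u) = Normc.normc c * L2normr u.
Proof.
elim/L2class_ind: u => f; apply: EFin_inj.
rewrite EFinM -[c *: _]L2classZ !L2normrE.
by apply: L2normZ; exact: L2fun_cmeasurable.
Qed.

Let L2normr_eq0 (u : L2) : L2normr u = 0 -> u = 0.
Proof.
elim/L2class_ind: u => f n0; have := L2normrE f; rewrite n0 => /esym.
move=> /(L2norm_eq0 mu (L2fun_cmeasurable _)) f0.
by rewrite -L2class0; apply/L2classE.
Qed.

Let normc_nat n : Normc.normc (n%:R : R[i]) = n%:R.
Proof.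
rewrite -(rmorph_nat (real_complex R)) /= expr0n addr0 sqrtr_sqr.
by rewrite normr_nat.
Qed.

Let L2normrMn (u : L2) n : L2normr (u *+ n) = L2normr u *+ n.
Proof. by rewrite -scaler_nat L2normrZ normc_nat mulr_natl. Qed.

Let L2normrN (u : L2) : L2normr (- u) = L2normr u.
Proof.
by rewrite -scaleN1r L2normrZ /Normc.normc/= oppr0 expr0n/= addr0 sqrrN expr1n sqrtr1 mul1r.
Qed.

(* L2 is a module over R[i], but its norm, hence its metric, takes values in R:
   it is not declared as a normed module over R[i], whose norm would be
   R[i]-valued. *)
HB.instance Definition _ := Num.Zmodule_isNormed.Build R L2
  L2normr_triangle L2normr_eq0 L2normrMn L2normrN.

HB.instance Definition _ := PseudoMetric.copy L2 (pseudoMetric_normed L2).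
HB.instance Definition _ := isPointed.Build L2 0.
HB.instance Definition _ := NormedZmod_PseudoMetric_eq.Build R L2 erefl.

Lemma normL2class f : `|L2class f|%:E = L2norm mu f.
Proof. exact: L2normrE. Qed.

Lemma scaleL2class c f : c *: L2class f = L2class (c *: f).
Proof. by rewrite L2classZ. Qed.

End L2_space.

Section approximation.
Context {d} {D : measurableType d} {R : realType}.
Variable mu : {measure set D -> \bar R}.
Implicit Types (n m : nat) (V : set (L2 mu)) (u v : L2 mu) (f g : L2fun mu).

Definition linearly_independent n (b : 'I_n -> L2 mu) :=
  forall c : 'I_n -> R[i], \sum_i c i *: b i = 0 -> forall i, c i = 0.

Definition subspace_of_dim n V :=
  exists2 b : 'I_n -> L2 mu, linearly_independent b &
    V = [set v | exists c : 'I_n -> R[i], v = \sum_i c i *: b i].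

Definition best_approximation V u v :=
  V v /\ forall w, V w -> `|u - v| <= `|u - w|.

(* Supremum in [0, +oo], so that the supremum of the empty set is 0. *)
Definition sup0 (S : set (\bar R)) : \bar R := maxe 0%E (ereal_sup S).

(* The infimum is +oo when L^2 has no subspace of dimension n. *)
Definition kolmogorov_width n (A : set (L2 mu)) : \bar R :=
  ereal_inf [set sup0 [set ereal_inf [set `|u - v|%:E | v in V] | u in A]
            | V in subspace_of_dim n].

Section sampling.
Context {d'} {Omega : measurableType d'} {P : probability Omega R} {m : nat}.
Variable X : {RV P >-> m.-tuple D}.
Variable Rec : m.-tuple D -> 'rV[R[i]]_m -> L2 mu.

Definition point_values (x : m.-tuple D) f : 'rV[R[i]]_m :=
  \row_i f (tnth x i).

Definition sqr_error f (w : Omega) : R :=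
  `|L2class f - Rec (X w) (point_values (X w) f)| ^+ 2.

(* Almost sure independence of the chosen representatives; measurability of
   the squared errors, without which their expectations are meaningless. *)
Definition well_posed :=
  (forall f g, f = g %[ae mu] -> \forall w \ae P,
     Rec (X w) (point_values (X w) f) = Rec (X w) (point_values (X w) g)) /\
  (forall f, measurable_fun [set: Omega] (sqr_error f)).

End sampling.

(* Ranging over f with class in A means ranging over u in A and over all
   representatives f of u. *)
Definition rand_sampling_number m (A : set (L2 mu)) : \bar R :=
  sqrte (ereal_inf [set e | exists (d' : measure_display)
      (Omega : measurableType d') (P : probability Omega R)
      (X : {RV P >-> m.-tuple D})
      (Rec : m.-tuple D -> {linear 'rV[R[i]]_m -> L2 mu}),
    well_posed X Rec /\
    e = sup0 [set 'E_P[sqr_error X Rec f] | f in @L2class _ _ _ mu @^-1` A]%E]).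

End approximation.

(* Main.v *)
Require Import Defs.
From HB Require Import structures.
From mathcomp Require Import all_boot all_order all_algebra.
From mathcomp.real_closed Require Import complex.
From mathcomp Require Import all_classical all_reals all_analysis.
From mathcomp Require Import measurable_realfun ring lra.
Import Order.TTheory GRing.Theory Num.Theory.
Import numFieldNormedType.Exports.
Set Implicit Arguments.
Unset Strict Implicit.
Unset Printing Implicit Defensive.
Local Open Scope classical_set_scope.
Local Open Scope ring_scope.
Local Open Scope sesquilinear_scope.

(* Let phi be an orthonormal basis of V and v(x) the column of the conjugates of
   the phi_j(x). A matrix M starts at 2n I, so that tr M^-1 = 1/2, and at each
   step M is replaced by M - I + w v(x) v(x)^*. With a = (M - I)^-1, b = M^-1 and
   S = tr a - tr b, put L(x) = v^* a^2 v / S - v^* a v, where v = v(x). By the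
   Sherman-Morrison formula, the choice w = 1 / L(x) at a point where L(x) > 0
   preserves positive definiteness and tr M^-1 = 1/2, while the integral of L is
   tr a^2 / S - tr a >= 1/2. Drawing x, given the past, with density L_+ over its
   integral therefore gives E(w g(x)) <= 2 int g for every g >= 0.
   After 4n draws M is positive definite, that is, the sum of the w_i v_i v_i^*
   exceeds 2n I. Hence the squared distance between the weighted least-squares
   fit of u and P_V u is at most the sum of the w_i |g(x_i)|^2 over 2n, where
   g = u - P_V u, and the expectation of this is at most 4 |g|^2. This gives C = 4
   and K = 1 + 4. The fit uses values only through w_i u(x_i), so that the
   inequality above also shows that it is almost surely independent of the
   representative of u. *)

(** * Hermitian forms and the barrier step *)

Section hermitian_forms.
Context {C : numClosedFieldType} {n : nat}.
Implicit Types (M N A B : 'M[C]_n) (v y : 'cV[C]_n).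

Lemma trmxC_mul m p q (A : 'M[C]_(m, p)) (B : 'M[C]_(p, q)) :
  (A *m B)^t* = B^t* *m A^t*.
Proof. by rewrite trmx_mul map_mxM. Qed.

Lemma trmxC_inv M : (invmx M)^t* = invmx (M^t*).
Proof. by rewrite trmx_inv map_invmx. Qed.

Lemma trmxCD m p (A B : 'M[C]_(m, p)) : (A + B)^t* = A^t* + B^t*.
Proof. by rewrite linearD map_mxD. Qed.

Lemma trmxCB m p (A B : 'M[C]_(m, p)) : (A - B)^t* = A^t* - B^t*.
Proof. by rewrite linearB map_mxB. Qed.

Lemma trmxCZ m p c (A : 'M[C]_(m, p)) : (c *: A)^t* = c^* *: A^t*.
Proof. by rewrite linearZ map_mxZ. Qed.

Lemma trmxC_scalar (c : C) : (c%:M : 'M[C]_n)^t* = (c^*)%:M.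
Proof. by rewrite tr_scalar_mx map_scalar_mx. Qed.

Definition qform M v : C := (v^t* *m M *m v) 0 0.

Lemma qformD M N v : qform (M + N) v = qform M v + qform N v.
Proof. by rewrite /qform mulmxDr mulmxDl mxE. Qed.

Lemma qformZ c M v : qform (c *: M) v = c * qform M v.
Proof. by rewrite /qform -scalemxAr -scalemxAl mxE. Qed.

Lemma qformB M N v : qform (M - N) v = qform M v - qform N v.
Proof. by rewrite -scaleN1r qformD qformZ mulN1r. Qed.

Lemma qform1 v : qform 1%:M v = \sum_i `|v i 0| ^+ 2.
Proof.
rewrite /qform mulmx1 mxE; apply: eq_bigr => i _.
by rewrite !mxE mulrC -normCK.
Qed.

Lemma qformC M v : (qform M v)^* = qform (M^t*) v.
Proof.
rewrite /qform -[RHS](_ : ((v^t* *m M *m v)^t*) 0 0 = _); last first.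
  by rewrite !trmxC_mul trmxCK mulmxA.
by rewrite !mxE.
Qed.

Lemma qform_outer (u v : 'cV[C]_n) : qform (u *m u^t*) v = `|(u^t* *m v) 0 0| ^+ 2.
Proof.
rewrite /qform mulmxA -mulmxA mxE big_ord1 normCK mulrC; congr (_ * _).
have -> : v^t* *m u = (u^t* *m v)^t* by rewrite trmxC_mul trmxCK.
by rewrite !mxE.
Qed.

Lemma qform_delta M (j : 'I_n) : qform M (delta_mx j 0) = M j j.
Proof.
rewrite /qform (_ : _^t* = delta_mx 0 j); first by rewrite -colE -rowE !mxE.
by apply/matrixP => k l; rewrite !mxE conjC_nat andbC.
Qed.

Lemma delta_mx_neq0 (j : 'I_n) : delta_mx j 0 != 0 :> 'cV[C]_n.
Proof.
apply/negP => /eqP/matrixP/(_ j 0).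
by rewrite !mxE !eqxx => /eqP; rewrite oner_eq0.
Qed.

Lemma qform_conj M N v : qform (N^t* *m M *m N) v = qform M (N *m v).
Proof. by rewrite /qform trmxC_mul !mulmxA. Qed.

Lemma qform_sum_trace M N : \sum_j qform M (col j N) = \tr (N^t* *m M *m N).
Proof.
apply: eq_bigr => j _; rewrite /qform !mxE; apply: eq_bigr => k _.
rewrite !mxE; congr (_ * _); apply: eq_bigr => l _; by rewrite !mxE.
Qed.

Lemma qform_sqr M v : M^t* = M -> qform (M *m M) v = qform 1%:M (M *m v).
Proof. by move=> hM; rewrite -qform_conj hM mulmx1. Qed.

Definition pdmx M := M^t* = M /\ forall v, v != 0 -> 0 < qform M v.

Lemma pdmx_ge0 M v : pdmx M -> 0 <= qform M v.
Proof.
case=> _ pM; have [->|/pM/ltW//] := eqVneq v 0.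
by rewrite /qform mulmx0 mxE.
Qed.

Lemma qform1_gt0 v : v != 0 -> 0 < qform 1%:M v.
Proof.
move=> v0; rewrite qform1 lt_def; apply/andP; split; last first.
  by apply: sumr_ge0 => i _; rewrite exprn_ge0.
apply: contra v0; rewrite psumr_eq0 => [/allP v0|i _]; last by rewrite exprn_ge0.
apply/eqP/matrixP => i j; rewrite ord1 mxE; apply/eqP.
by have := v0 i (mem_index_enum _); rewrite /= sqrf_eq0 normr_eq0.
Qed.

(** A row [r] of the left kernel makes the form vanish at [r^t*], which strict positivity allows
    only for [r = 0]. *)
Lemma pdmx_unit M : pdmx M -> M \in unitmx.
Proof.
move=> [hM pM]; rewrite -row_free_unit -kermx_eq0.
apply/eqP/row_matrixP => i; rewrite row0.
have /sub_kermxP k0 := row_sub i (kermx M).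
apply/eqP/negbNE/negP => r0.
have /pM : (row i (kermx M))^t* != 0.
  by apply: contra r0 => /eqP r0; rewrite -[row _ _]trmxCK r0 trmx0 map_mx0.
by rewrite /qform trmxCK k0 mul0mx mxE ltxx.
Qed.

Lemma pdmx_inv M : pdmx M -> pdmx (invmx M).
Proof.
move=> pM; have uM := pdmx_unit pM; have [hM qM] := pM; split.
  by rewrite trmxC_inv hM.
move=> v v0; have := qM (invmx M *m v).
rewrite -qform_conj trmxC_inv hM mulVmx// mul1mx; apply.
by apply: contra v0 => /eqP/(congr1 (mulmx M)); rewrite mulKVmx// mulmx0 => ->.
Qed.

Lemma pdmx_trace_ge0 M N : pdmx M -> 0 <= \tr (N^t* *m M *m N).
Proof.
by move=> pM; rewrite -qform_sum_trace sumr_ge0// => j _; exact: pdmx_ge0.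
Qed.

Lemma pdmx_trace_gt0 M : (0 < n)%N -> pdmx M -> 0 < \tr M.
Proof.
move=> n0 pM; have -> : \tr M = \sum_j qform M (col j 1%:M).
  by rewrite qform_sum_trace trmxC_scalar rmorph1 mul1mx mulmx1.
pose j := Ordinal n0.
rewrite (bigD1 j)//= ltr_pwDl//; last by apply: sumr_ge0 => i _; exact: pdmx_ge0.
apply: (proj2 pM); apply/negP => /eqP/matrixP/(_ j 0).
by rewrite !mxE eqxx => /eqP; rewrite oner_eq0.
Qed.

Lemma pdmxD M N : pdmx M -> pdmx N -> pdmx (M + N).
Proof.
move=> [hM pM] [hN pN]; split; first by rewrite trmxCD hM hN.
by move=> v v0; rewrite qformD addr_gt0 ?pM ?pN.
Qed.

Lemma pdmx_sqr M : pdmx M -> pdmx (M *m M).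
Proof.
move=> pM; have [hM qM] := pM; split; first by rewrite trmxC_mul hM.
move=> v v0; rewrite qform_sqr// qform1_gt0//.
apply: contra v0 => /eqP/(congr1 (mulmx (invmx M))).
by rewrite mulKmx ?pdmx_unit// mulmx0 => ->.
Qed.

Lemma pdmx_add_outer M (t : C) v : 0 <= t -> pdmx M -> pdmx (M + t *: (v *m v^t*)).
Proof.
move=> t0 [hM qM]; split.
  by rewrite trmxCD hM trmxCZ trmxC_mul trmxCK (CrealP (ger0_real t0)).
move=> y y0; rewrite qformD qformZ qform_outer ltr_wpDr ?qM//.
by rewrite mulr_ge0// exprn_ge0.
Qed.

(* Cauchy-Schwarz for the form M applied to y and the columns of M^-1. *)
Lemma qform1_le_trace M y : pdmx M -> qform 1%:M y <= \tr (invmx M) * qform M y.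
Proof.
move=> pM; have uM := pdmx_unit pM; have [hM qM] := pM.
have [hb qb] := pdmx_inv pM; set b := invmx M in hb qb *.
rewrite qform1 /mxtrace mulr_suml; apply: ler_sum => j _.
pose e : 'cV[C]_n := delta_mx j 0.
have eC : e^t* = delta_mx 0 j by apply/matrixP => k l; rewrite !mxE conjC_nat andbC.
have b0 : 0 < b j j by rewrite -qform_delta qb// delta_mx_neq0.
(* [z] is [y] minus its projection, orthogonal for the form [M], on column [j] of [b]. Nonnegativity
   of the form at [z] bounds the [j]-th term. *)
pose t := y j 0 / b j j; pose z := y - t *: (b *m e).
have zE : qform M z = qform M y - `|y j 0| ^+ 2 / b j j.
  have -> : qform M z = qform M y - t * (y^t* *m e) 0 0
      - t^* * (e^t* *m y) 0 0 + (t^* * t) * qform b e.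
    rewrite /qform /z trmxCB trmxCZ trmxC_mul hb !mulmxBl !mulmxBr.
    rewrite -!scalemxAr -!scalemxAl -!mulmxA !(mulmxA M) mulmxV// mul1mx.
    rewrite !(mulmxA b) mulVmx// mul1mx !mxE; ring.
  rewrite qform_delta eC -colE -rowE !mxE normCK /t rmorphM fmorphV /=.
  have /CrealP -> := ger0_real (ltW b0).
  by field; rewrite gt_eqF.
by have := pdmx_ge0 z pM; rewrite zE subr_ge0 ler_pdivrMr// mulrC.
Qed.

(* Lower barrier of Batson, Spielman and Srivastava, shifted by 1: qform of
   barrier_mx M at u is positive iff some t > 0 keeps the trace of the inverse
   of M - 1 + t u u^* below that of M^-1, and then its inverse is the least such t. *)
Definition barrier_mx M :=
  (\tr (invmx (M - 1%:M)) - \tr (invmx M))^-1 *: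
  (invmx (M - 1%:M) *m invmx (M - 1%:M)) - invmx (M - 1%:M).

Section barrier.
Variable M : 'M[C]_n.
Hypotheses (n0 : (0 < n)%N) (pM : pdmx M) (trM : \tr (invmx M) = 2^-1).

Let M' := M - 1%:M.
Let a := invmx M'.
Let b := invmx M.
Let S := \tr a - \tr b.

(** By [qform1_le_trace] the squared norm is at most half of the form [M], so a trace of one half
    leaves room for a shift by 1. *)
Lemma pdmx_sub1 : pdmx M'.
Proof.
have [hM qM] := pM; split; first by rewrite trmxCB hM trmxC_scalar rmorph1.
move=> v v0; rewrite qformB subr_gt0.
apply: le_lt_trans (qform1_le_trace v pM) _.
by rewrite trM gtr_pMl ?qM// invf_lt1 ?ltr1n.
Qed.

Let uM' : M' \in unitmx. Proof. exact: pdmx_unit pdmx_sub1. Qed.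
Let ha : a^t* = a. Proof. by have [] := pdmx_inv pdmx_sub1. Qed.

(** Resolvent identity: [a - b = a (M - M') b], and [M - M'] is the identity. *)
Let ab_eq : a = b + a *m b.
Proof.
have uM := pdmx_unit pM.
have : a *m (M - M') *m b = a - b.
  by rewrite mulmxBr mulmxBl mulmxK// /a mulVmx// mul1mx.
rewrite opprB addrCA subrr addr0 mulmx1 => ->.
by rewrite addrCA subrr addr0.
Qed.

Let ba_eq : a = b + b *m a.
Proof.
have uM := pdmx_unit pM.
have : b *m (M - M') *m a = a - b.
  by rewrite mulmxBr mulmxBl mulVmx// mul1mx /a mulmxK.
rewrite opprB addrCA subrr addr0 mulmx1 => ->.
by rewrite addrCA subrr addr0.
Qed.

Let S_ab : S = \tr (a *m b).
Proof. by rewrite /S {1}ab_eq mxtraceD addrC addKr. Qed.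

(** [S] is the trace of [a b], the inverse of [M M' = M'^2 + M'], which is a sum of two positive
    definite matrices. *)
Lemma barrier_shift_gt0 : 0 < S.
Proof.
have uM := pdmx_unit pM.
have -> : S = \tr (invmx (M' *m M' + M')).
  rewrite S_ab; congr mxtrace; symmetry.
  have -> : M' *m M' + M' = M *m M'.
    by rewrite -[X in _ + X]mul1mx -mulmxDl /M' subrK.
  have uN : M *m M' \in unitmx by rewrite unitmx_mul uM.
  rewrite -[RHS](mulKmx uN) !mulmxA -(mulmxA _ M') /a mulmxV// mulmx1 mulmxK//.
apply/pdmx_trace_gt0/pdmx_inv => //.
by apply: pdmxD; [apply: pdmx_sqr|]; exact: pdmx_sub1.
Qed.

Lemma barrier_mx_herm : (barrier_mx M)^t* = barrier_mx M.
Proof.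
rewrite trmxCB trmxCZ trmxC_mul -/a ha; congr (_ *: _ - _).
by apply: conj_Creal; rewrite rpredV -/S gtr0_real// barrier_shift_gt0.
Qed.

(** Since [tr a = S + 1/2], the claim reads [S + S^2 <= tr (a a)]. As [tr (a a) = S + tr (a b a)],
    it remains to bound the last trace below by [S^2]. *)
Lemma barrier_mx_trace_ge : 2^-1 <= \tr (barrier_mx M).
Proof.
rewrite raddfB /= mxtraceZ -/a -/b -/S mulrC.
have S0 := barrier_shift_gt0.
have aab : \tr (a *m a) = S + \tr (a *m b *m a).
  by rewrite {2}ba_eq mulmxDr mxtraceD -S_ab mulmxA.
(* Expand [tr ((a - S) b (a - S)) >= 0] with [tr (a b) = S] and [tr b = 1/2]: it says
   [tr (a b a) >= 2 S^2 - S^2 / 2]. *)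
have hS : 3 / 2 * S ^+ 2 <= \tr (a *m b *m a).
  have := pdmx_trace_ge0 (a - S%:M) (pdmx_inv pM).
  rewrite trmxCB ha trmxC_scalar (CrealP (gtr0_real S0)) -/b.
  rewrite !mulmxBl !mulmxBr !mul_scalar_mx !mul_mx_scalar -!scalemxAl.
  rewrite !raddfB /= !mxtraceZ (mxtrace_mulC b a) -S_ab trM.
  rewrite -subr_ge0 => H; rewrite -subr_ge0.
  by apply: le_trans H _; rewrite le_eqVlt; apply/orP; left; apply/eqP; field.
have trE : \tr a = S + 2^-1 by rewrite /S trM subrK.
rewrite lerBrDr ler_pdivlMr// aab trE.
have -> : (2^-1 + (S + 2^-1)) * S = S + S ^+ 2 by field.
rewrite lerD2l (le_trans _ hS)// ler_peMl ?exprn_ge0 ?(ltW S0)//.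
by rewrite ler_pdivlMr// mul1r ler_nat.
Qed.

Variable v : 'cV[C]_n.
Let L := qform (barrier_mx M) v.
Hypothesis L0 : 0 < L.
Let N := M' + L^-1 *: (v *m v^t*).

Let LE : L = qform (a *m a) v / S - qform a v.
Proof. by rewrite /L qformB qformZ mulrC. Qed.

Lemma barrier_step_pd : pdmx N.
Proof. by apply: pdmx_add_outer pdmx_sub1; rewrite invr_ge0 ltW. Qed.

(* Sherman-Morrison; the weight 1/L makes the trace drop by exactly S. *)
Lemma barrier_step_trace : \tr (invmx N) = 2^-1.
Proof.
have S0 := barrier_shift_gt0.
have q0 : 0 <= qform a v := pdmx_ge0 v (pdmx_inv pdmx_sub1).
have r0 : 0 < qform (a *m a) v.
  have : 0 < qform (a *m a) v / S by rewrite -(subrK (qform a v) (_ / _)) -LE ltr_pwDl.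
  by rewrite pmulr_lgt0// invr_gt0.
set q := qform a v in q0 *; set r := qform (a *m a) v in r0 *.
(* The Sherman-Morrison coefficient is [L^-1 / (1 + q / L) = 1 / (L + q)], which is [S / r] because
   [L = r / S - q]. *)
pose t := S / r.
have NE : N *m (a - t *: (a *m v *m v^t* *m a)) = 1%:M.
  have vav : v *m v^t* *m (a *m v *m v^t* *m a) = q *: (v *m v^t* *m a).
    rewrite -!mulmxA (mulmxA (v^t*) a) (mulmxA (v^t* *m a) v).
    rewrite [v^t* *m a *m v]mx11_scalar -/(qform a v) -/q.
    by rewrite mul_scalar_mx -scalemxAr.
  rewrite /N mulmxDl !mulmxBr -!scalemxAr -!scalemxAl vav.
  rewrite !mulmxA /a mulmxV// mul1mx -addrA -[RHS]addr0; congr (_ + _).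
  rewrite -/a scalerA scalerA -scalerBl -scaleNr -scalerDl.
  have -> : - t + (L^-1 - t / L * q) = 0; last by rewrite scale0r.
  have Lr : L = r / S - q := LE.
  have Ln : L != 0 by rewrite gt_eqF.
  have qE : q = r / S - L by rewrite Lr opprB addrC subrK.
  by rewrite /t qE; field; rewrite Ln (gt_eqF S0) (gt_eqF r0).
have -> : invmx N = a - t *: (a *m v *m v^t* *m a).
  by rewrite -[RHS](mulKmx (pdmx_unit barrier_step_pd)) NE mulmx1.
have trr : \tr (a *m v *m v^t* *m a) = r.
  by rewrite -mulmxA mxtrace_mulC mulmxA -[RHS]trace_mx11 /r /qform !mulmxA.
rewrite raddfB /= mxtraceZ trr.
by rewrite /t divfK ?gt_eqF// /S opprB addrCA subrr addr0.
Qed.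

End barrier.


(** * Least-squares inequality and orthonormalization of a form *)

Lemma qform_sum (I : finType) (A : I -> 'M[C]_n) y :
  qform (\sum_i A i) y = \sum_i qform (A i) y.
Proof. by rewrite /qform mulmx_sumr mulmx_suml summxE. Qed.

(** Let [p i] be the value at [i] of the fit [y] to the data [g]. By the normal equations the form
    of [M + c] at [y] is both the sum of [w |p|^2] and that of [w g p^*], so nonnegativity of the
    sum of [w |g - p|^2] bounds it by the sum of [w |g|^2]. Positivity of [M] supplies the factor
    [c]. *)
Lemma weighted_least_squares (I : finType) (w g : I -> C) (v : I -> 'cV[C]_n)
    (M : 'M[C]_n) (c : C) (y : 'cV[C]_n) :
  (forall i, 0 <= w i) -> pdmx M ->
  M + c%:M = \sum_i w i *: (v i *m (v i)^t*) ->
  (M + c%:M) *m y = \sum_i (w i * g i) *: v i ->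
  c * qform 1%:M y <= \sum_i w i * `|g i| ^+ 2.
Proof.
move=> w0 pM GE Gy; pose p i := ((v i)^t* *m y) 0 0.
have qG : qform (M + c%:M) y = \sum_i w i * `|p i| ^+ 2.
  by rewrite GE qform_sum; apply: eq_bigr => i _; rewrite qformZ qform_outer.
have qr : qform (M + c%:M) y = \sum_i w i * (g i * (p i)^*).
  rewrite /qform -mulmxA Gy mulmx_sumr summxE; apply: eq_bigr => i _.
  rewrite -scalemxAr mxE -mulrA; congr (_ * (_ * _)).
  have -> : y^t* *m v i = ((v i)^t* *m y)^t* by rewrite trmxC_mul trmxCK.
  by rewrite mxE [X in X^* = _]mxE.
have qle : c * qform 1%:M y <= qform (M + c%:M) y.
  by rewrite qformD -(scalemx1 _ c) qformZ lerDr pdmx_ge0.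
apply: le_trans qle _.
have qR : (qform (M + c%:M) y)^* = qform (M + c%:M) y.
  rewrite qG rmorph_sum; apply: eq_bigr => i _; apply: CrealP.
  by rewrite realM ?ger0_real ?exprn_ge0.
(* With the form added to both sides, the left side becomes the cross term plus its conjugate. What
   is left is [0 <= |g - p|^2], term by term. *)
rewrite -(lerD2r (qform (M + c%:M) y)) -{1}qR {1}qr {1}qr {1}qG.
rewrite rmorph_sum -!big_split /=; apply: ler_sum => i _.
rewrite !rmorphM /= conjCK (CrealP (ger0_real (w0 i))) -!mulrDr ler_wpM2l//.
have := exprn_ge0 2 (normr_ge0 (g i - p i)).
rewrite !normCK rmorphB => H; rewrite -subr_ge0.
by apply: le_trans H _; rewrite le_eqVlt; apply/orP; left; apply/eqP; ring.
Qed.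

(** The factor comes from the spectral theorem and is not triangular: if [P] is unitary and
    diagonalizes [G], then [S] is [P^t*] times the inverse square roots of the eigenvalues. *)
Lemma pdmx_cholesky (G : 'M[C]_n) : pdmx G ->
  exists2 S : 'M[C]_n, S \in unitmx & S^t* *m G *m S = 1%:M.
Proof.
move=> [hG qG].
have hermG : G \is hermsymmx.
  by apply/is_hermitianmxP; rewrite expr0 scale1r hG.
have nG := hermitian_normalmx hermG.
have uP := spectral_unitarymx G; set P := spectralmx G in uP.
have GE := orthomx_spectralP nG; rewrite -/P invmx_unitary// in GE.
set sp := spectral_diag G in GE.
have /unitarymxP PPt := uP.
have sp0 i : 0 < sp 0 i.
  have -> : sp 0 i = qform G (P^t* *m delta_mx i 0).
    rewrite -qform_conj trmxCK GE !mulmxA PPt mul1mx -mulmxA PPt mulmx1.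
    by rewrite qform_delta mxE eqxx mulr1n.
  apply: qG; apply: contra (delta_mx_neq0 i) => /eqP /(congr1 (mulmx P)).
  by rewrite mulmxA PPt mul1mx mulmx0 => ->.
pose D : 'rV[C]_n := \row_i (sqrtC (sp 0 i))^-1.
exists (P^t* *m diag_mx D).
  rewrite unitmx_mul -invmx_unitary// unitmx_inv unitarymx_unit//=.
  rewrite unitmxE det_diag unitfE prodf_seq_neq0; apply/allP => i _ /=.
  by rewrite mxE invr_eq0 sqrtC_eq0 gt_eqF.
rewrite trmxC_mul trmxCK tr_diag_mx map_diag_mx {1}GE !mulmxA.
rewrite -(mulmxA _ P) PPt mulmx1 -(mulmxA _ P) PPt mulmx1 !mulmx_diag.
apply/matrixP => i j; rewrite !mxE; congr (_ *+ _).
rewrite /=; have -> : ((sqrtC (sp 0 i))^-1)^* = (sqrtC (sp 0 i))^-1.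
  by apply: conj_Creal; rewrite rpredV ger0_real// sqrtC_ge0 ltW.
by rewrite mulrAC -invfM -expr2 sqrtCK mulVf// gt_eqF.
Qed.

End hermitian_forms.

(** * Densities and conditional draws *)

Section density.
Local Open Scope ereal_scope.
Context {d} {T : measurableType d} {R : realType}.
Variables (mu : {measure set T -> \bar R}) (q : T -> R).
Hypotheses (q0 : forall x, (0 <= q x)%R) (mq : measurable_fun [set: T] q).

(* The two proofs are arguments so that the measure instance can be inferred. *)
Definition density of (forall x, (0 <= q x)%R) & measurable_fun [set: T] q :=
  fun A : set T => \int[mu]_(x in A) (q x)%:E.
Local Notation nu := (density q0 mq).

Let density0 : nu set0 = 0. Proof. exact: integral_set0. Qed.

Let density_ge0 A : 0 <= nu A.
Proof. by apply: integral_ge0 => x _; rewrite lee_fin. Qed.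

Let density_sigma_additive : semi_sigma_additive nu.
Proof.
move=> /= F mF tF mUF; rewrite /density; apply: cvg_toP.
  apply: ereal_nondecreasing_is_cvgn => m n mn.
  apply: lee_sum_nneg_natr => // k _ _.
  by apply: integral_ge0 => /= x Fkx; rewrite lee_fin.
rewrite ge0_integral_bigcup//=; first exact/measurable_funTS/measurable_EFinP.
by move=> x _; rewrite lee_fin.
Qed.

HB.instance Definition _ := isMeasure.Build _ _ _ nu
  density0 density_ge0 density_sigma_additive.

Import HBNNSimple.

(** Both sides are limits along the same increasing simple functions, and for an indicator the
    formula is the definition of [density]. *)
Lemma integral_density f : (forall x, 0 <= f x) -> measurable_fun [set: T] f ->
  \int[nu]_x f x = \int[mu]_x (f x * (q x)%:E).
Proof.
move=> f0 mf; pose h := nnsfun_approx measurableT mf.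
have hf x : (EFin \o h n) x @[n --> \oo] --> f x.
  by apply: cvg_nnsfun_approx => //.
have -> : \int[nu]_x f x = lim (\int[nu]_x (EFin \o h n) x @[n --> \oo]).
  under eq_integral => x _ do rewrite -(cvg_lim _ (hf x))//.
  apply: monotone_convergence => //.
  - by move=> n; exact/measurable_EFinP/measurable_funP.
  - by move=> n x Ex //=; rewrite lee_fin.
  - by move=> x Ex a b ab; rewrite lee_fin; exact/lefP/nd_nnsfun_approx.
have -> : \int[mu]_x (f x * (q x)%:E) =
    lim (\int[mu]_x ((EFin \o h n) x * (q x)%:E) @[n --> \oo]).
  have hq x : ((EFin \o h n) x * (q x)%:E) @[n --> \oo] --> f x * (q x)%:E.
    exact: cvgeZr.
  under eq_integral => x _ do rewrite -(cvg_lim _ (hq x))//.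
  apply: monotone_convergence => //.
  - move=> n; apply: emeasurable_funM; last exact/measurable_EFinP.
    exact/measurable_EFinP/measurable_funP.
  - by move=> n x _; rewrite mule_ge0 ?lee_fin.
  - move=> x _ a b ab/=; rewrite lee_wpmul2r ?lee_fin//.
    exact/lefP/nd_nnsfun_approx.
congr (lim (_ @[_ --> \oo])); apply/funext => n.
have mh r : measurable_fun [set: T] (fun x => (r * \1_(h n @^-1` [set r]) x)%:E).
  by apply/measurable_EFinP; exact: measurable_funM.
transitivity (\int[nu]_x
    (\sum_(y \in range (h n)) (y * \1_(h n @^-1` [set y]) x)%:E)).
  by apply: eq_integral => t _; rewrite /= fimfunE -fsumEFin.
rewrite ge0_integral_fsum//; last by move=> m y Ey; exact: nnfun_muleindic_ge0.
transitivity (\int[mu]_x (\sum_(y \in range (h n))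
    (y * \1_(h n @^-1` [set y]) x)%:E * (q x)%:E)); last first.
  apply: eq_integral => x _.
  rewrite -ge0_mule_fsuml => [|y]; last exact: nnfun_muleindic_ge0.
  by rewrite fsumEFin// -(fimfunE _ x).
rewrite ge0_integral_fsum//; last 2 first.
  - by move=> y; apply: emeasurable_funM => //; exact/measurable_EFinP.
  - by move=> m y Ey; apply: mule_ge0; [exact: nnfun_muleindic_ge0|rewrite lee_fin].
apply: eq_fsbigr => r rhn; have r0 : (0 <= r)%R.
  by move: rhn; rewrite inE => -[t _ <-].
under [LHS]eq_integral do rewrite EFinM.
rewrite integralZl_indic_nnsfun//.
under [RHS]eq_integral do rewrite EFinM -muleA.
rewrite ge0_integralZl//.
- rewrite integral_indic// setIT; congr (_ * _).
  under eq_integral do rewrite muleC.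
  rewrite [LHS](integral_mkcond (h n @^-1` [set r])).
  by apply: eq_integral => x _; rewrite epatch_indic.
- by apply: emeasurable_funM; exact/measurable_EFinP.
- by move=> t Et; rewrite mule_ge0 ?lee_fin.
Qed.

End density.

Section draw.
Local Open Scope ereal_scope.
Context {d1 d2} {T1 : measurableType d1} {T2 : measurableType d2} {R : realType}.

(** [Q] is the joint law of [t] drawn from [P] and of a point whose law given [t] has density
    [q (t, _)] with respect to [rho]. It has density [q] with respect to the product measure; the
    formula is Tonelli's theorem. *)
Lemma draw (P : probability T1 R) (rho : probability T2 R) (q : T1 * T2 -> R) :
  (forall z, (0 <= q z)%R) -> measurable_fun [set: T1 * T2] q ->
  (forall t, \int[rho]_x (q (t, x))%:E = 1) ->
  exists Q : probability (T1 * T2)%type R, forall F : T1 * T2 -> \bar R,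
    (forall z, 0 <= F z) -> measurable_fun [set: T1 * T2] F ->
    \int[Q]_z F z = \int[P]_t \int[rho]_x (F (t, x) * (q (t, x))%:E).
Proof.
move=> q0 mq q1; pose nu := density (P \x rho) q0 mq.
have fub F : (forall z, 0 <= F z) -> measurable_fun [set: T1 * T2] F ->
    \int[nu]_z F z = \int[P]_t \int[rho]_x (F (t, x) * (q (t, x))%:E).
  move=> F0 mF; rewrite integral_density// fubini_tonelli1//.
  - by apply: emeasurable_funM => //; exact/measurable_EFinP.
  - by move=> z; rewrite mule_ge0 ?lee_fin.
have nu1 : nu setT = 1.
  rewrite -[LHS]mul1e -integral_cst// fub//.
  under eq_integral do under eq_integral do rewrite mul1e.
  under eq_integral do rewrite q1.
  by rewrite integral_cst// mul1e; exact: probability_setT.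
pose m := Measure_isProbability.Build _ _ _ nu nu1.
pose Q : probability (T1 * T2)%type R := HB.pack nu m.
by exists Q.
Qed.

End draw.

(** * Measurability of complex matrices *)

Section cmeasurable.
Context {d} {T : measurableType d} {R : realType}.
Implicit Types f g : T -> R[i].

(** On nonnegative reals the inverse is the power -1, even at 0, where both are 0. *)
Lemma measurable_invr_ge0 (f : T -> R) : (forall x, 0 <= f x) ->
  measurable_fun [set: T] f -> measurable_fun [set: T] (fun x => (f x)^-1).
Proof.
move=> f0 mf; rewrite (_ : (fun _ => _) = (@powR R)^~ (-1) \o f).
  exact: measurableT_comp.
by apply/funext => x /=; rewrite powR_inv1.
Qed.

Lemma cmeasurable_cst (c : R[i]) : cmeasurable (fun _ : T => c).
Proof. by split; exact: measurable_cst. Qed.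

Lemma cmeasurable_real (f : T -> R) :
  measurable_fun [set: T] f -> cmeasurable (fun x => (f x)%:C%C).
Proof. by move=> mf; split => //=; exact: measurable_cst. Qed.

Lemma cmeasurableM f g :
  cmeasurable f -> cmeasurable g -> cmeasurable (fun x => f x * g x).
Proof.
move=> [fr fi] [gr gi]; split.
  rewrite (_ : (fun _ => _) = (fun x => complex.Re (f x) * complex.Re (g x)
    - complex.Im (f x) * complex.Im (g x))).
    by apply: measurable_funB; exact: measurable_funM.
  by apply/funext => x; case: (f x) (g x) => [? ?] [? ?].
rewrite (_ : (fun _ => _) = (fun x => complex.Re (f x) * complex.Im (g x)
    + complex.Im (f x) * complex.Re (g x))).
  by apply: measurable_funD; exact: measurable_funM.
by apply/funext => x; case: (f x) (g x) => [? ?] [? ?].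
Qed.

Lemma cmeasurable_conj f : cmeasurable f -> cmeasurable (fun x => (f x)^*).
Proof.
move=> [fr fi]; split.
  rewrite (_ : (fun _ => _) = (fun x => complex.Re (f x)))//.
  by apply/funext => x; case: (f x).
rewrite (_ : (fun _ => _) = (fun x => - complex.Im (f x))).
  exact: measurableT_comp.
by apply/funext => x; case: (f x).
Qed.

Lemma cmeasurableN f : cmeasurable f -> cmeasurable (fun x => - f x).
Proof.
move=> mf; rewrite (_ : (fun _ => _) = (fun x => -1 * f x)).
  by apply: cmeasurableM => //; exact: cmeasurable_cst.
by apply/funext => x; rewrite mulN1r.
Qed.

Lemma cmeasurable_inv f : cmeasurable f -> cmeasurable (fun x => (f x)^-1).
Proof.
move=> [fr fi].
pose n2 x := complex.Re (f x) ^+ 2 + complex.Im (f x) ^+ 2.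
have mn : measurable_fun [set: T] (fun x => (n2 x)^-1).
  apply: measurable_invr_ge0 => [x|]; first by rewrite addr_ge0 ?sqr_ge0.
  by apply: measurable_funD; exact: measurable_funX.
split.
  rewrite (_ : (fun _ => _) = (fun x => complex.Re (f x) * (n2 x)^-1)).
    exact: measurable_funM.
  by apply/funext => x; rewrite /n2; case: (f x).
rewrite (_ : (fun _ => _) = (fun x => - (complex.Im (f x) * (n2 x)^-1))).
  by apply: measurableT_comp => //; exact: measurable_funM.
by apply/funext => x; rewrite /n2; case: (f x).
Qed.

Lemma cmeasurable_sum (I : Type) (r : seq I) (p : pred I) (h : I -> T -> R[i]) :
  (forall i, cmeasurable (h i)) -> cmeasurable (fun x => \sum_(i <- r | p i) h i x).
Proof.
move=> mh; elim: r => [|i r IH].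
  by under eq_fun do rewrite big_nil; exact: cmeasurable_cst.
under eq_fun do rewrite big_cons; case: (p i) => //.
exact: (cmeasurableD (mh i) IH).
Qed.

Lemma cmeasurable_prod (I : Type) (r : seq I) (p : pred I) (h : I -> T -> R[i]) :
  (forall i, cmeasurable (h i)) -> cmeasurable (fun x => \prod_(i <- r | p i) h i x).
Proof.
move=> mh; elim: r => [|i r IH].
  by under eq_fun do rewrite big_nil; exact: cmeasurable_cst.
under eq_fun do rewrite big_cons; case: (p i) => //.
exact: cmeasurableM.
Qed.

Lemma measurable_neq0 f : cmeasurable f -> measurable_fun [set: T] (fun x => f x != 0).
Proof.
move=> [fr fi].
rewrite (_ : (fun _ => _) =
    (fun x => ~~ ((complex.Re (f x) == 0) && (complex.Im (f x) == 0)))).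
  apply: measurable_neg; apply: measurable_and.
    by apply: measurable_fun_eqr => //; exact: measurable_cst.
  by apply: measurable_fun_eqr => //; exact: measurable_cst.
by apply/funext => x; rewrite eq_complex.
Qed.

Lemma cmeasurable_if (b : T -> bool) f g : measurable_fun [set: T] b ->
  cmeasurable f -> cmeasurable g -> cmeasurable (fun x => if b x then f x else g x).
Proof.
move=> mb [fr fi] [gr gi]; split.
  rewrite (_ : (fun _ => _) =
      fun x => if b x then complex.Re (f x) else complex.Re (g x)).
    exact: measurable_fun_ifT.
  by apply/funext => x; case: ifP.
rewrite (_ : (fun _ => _) =
    fun x => if b x then complex.Im (f x) else complex.Im (g x)).
  exact: measurable_fun_ifT.
by apply/funext => x; case: ifP.
Qed.

Definition mxmeasurable m n (A : T -> 'M[R[i]]_(m, n)) :=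
  forall i j, cmeasurable (fun x => A x i j).

Lemma mxmeasurable_cst m n (A : 'M[R[i]]_(m, n)) : mxmeasurable (fun=> A).
Proof. by move=> i j; exact: cmeasurable_cst. Qed.

Lemma mxmeasurableD m n (A B : T -> 'M[R[i]]_(m, n)) :
  mxmeasurable A -> mxmeasurable B -> mxmeasurable (fun x => A x + B x).
Proof.
by move=> mA mB i j; under eq_fun do rewrite mxE; exact: cmeasurableD.
Qed.

Lemma mxmeasurableZ m n (c : T -> R[i]) (A : T -> 'M[R[i]]_(m, n)) :
  cmeasurable c -> mxmeasurable A -> mxmeasurable (fun x => c x *: A x).
Proof.
by move=> mA mB i j; under eq_fun do rewrite mxE; exact: cmeasurableM.
Qed.

Lemma mxmeasurable_mul m n p (A : T -> 'M[R[i]]_(m, n)) (B : T -> 'M[R[i]]_(n, p)) :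
  mxmeasurable A -> mxmeasurable B -> mxmeasurable (fun x => A x *m B x).
Proof.
move=> mA mB i j; under eq_fun do rewrite mxE.
by apply: cmeasurable_sum => k; exact: cmeasurableM.
Qed.

Lemma mxmeasurable_trC m n (A : T -> 'M[R[i]]_(m, n)) :
  mxmeasurable A -> mxmeasurable (fun x => (A x)^t*).
Proof.
by move=> mA i j; under eq_fun do rewrite !mxE; exact: cmeasurable_conj.
Qed.

Lemma cmeasurable_tr n (A : T -> 'M[R[i]]_n) :
  mxmeasurable A -> cmeasurable (fun x => \tr (A x)).
Proof. by move=> mA; apply: cmeasurable_sum => i. Qed.

Lemma cmeasurable_det n (A : T -> 'M[R[i]]_n) :
  mxmeasurable A -> cmeasurable (fun x => \det (A x)).
Proof.
move=> mA; apply: cmeasurable_sum => s; apply: cmeasurableM.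
  exact: cmeasurable_cst.
exact: cmeasurable_prod.
Qed.

Lemma mxmeasurable_inv n (A : T -> 'M[R[i]]_n) :
  mxmeasurable A -> mxmeasurable (fun x => invmx (A x)).
Proof.
move=> mA i j.
(* [invmx] returns a singular matrix unchanged; elsewhere Cramer's rule applies. *)
rewrite (_ : (fun _ => _) = fun x => if \det (A x) != 0 then
   (\det (A x))^-1 * cofactor (A x) j i else A x i j); last first.
  apply/funext => x; rewrite /invmx unitmxE unitfE; case: ifP => // _.
  by rewrite !mxE.
apply: cmeasurable_if => //; first exact/measurable_neq0/cmeasurable_det.
apply: cmeasurableM; first exact/cmeasurable_inv/cmeasurable_det.
apply: cmeasurableM; first exact: cmeasurable_cst.
by apply: cmeasurable_det => k l; under eq_fun do rewrite !mxE.
Qed.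

Lemma cmeasurable_qform n (A : T -> 'M[R[i]]_n) (v : T -> 'cV[R[i]]_n) :
  mxmeasurable A -> mxmeasurable v -> cmeasurable (fun x => qform (A x) (v x)).
Proof.
move=> mA mv.
suff : mxmeasurable (fun x => (v x)^t* *m A x *m v x) by apply.
apply: mxmeasurable_mul => //; apply: mxmeasurable_mul => //.
exact: mxmeasurable_trC.
Qed.

End cmeasurable.

(** * Orthonormal families in L2 *)

Lemma sqr_normc (R : rcfType) (z : R[i]) :
  Normc.normc z ^+ 2 = complex.Re z ^+ 2 + complex.Im z ^+ 2.
Proof. by case: z => a b; rewrite /= sqr_sqrtr// addr_ge0 ?sqr_ge0. Qed.

Lemma normr_normc (R : rcfType) (z : R[i]) : `|z| = (Normc.normc z)%:C%C.
Proof. by []. Qed.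

Section cint.
Context {d} {D : measurableType d} {R : realType}.
Variable mu : {measure set D -> \bar R}.
Implicit Types (h : D -> R[i]) (f g : L2fun mu).

Definition cintegrable h :=
  mu.-integrable [set: D] (fun x => (complex.Re (h x))%:E) /\
  mu.-integrable [set: D] (fun x => (complex.Im (h x))%:E).

Definition cint h : R[i] :=
  Complex (\int[mu]_x complex.Re (h x)) (\int[mu]_x complex.Im (h x)).

Lemma cintegrableD h1 h2 : cintegrable h1 -> cintegrable h2 ->
  cintegrable (fun x => h1 x + h2 x).
Proof.
move=> [r1 i1] [r2 i2]; split.
  apply: eq_integrable (integrableD measurableT r1 r2) => // x _ /=.
  by rewrite raddfD.
apply: eq_integrable (integrableD measurableT i1 i2) => // x _ /=.
by rewrite raddfD.
Qed.

Lemma cintD h1 h2 : cintegrable h1 -> cintegrable h2 ->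
  cint (fun x => h1 x + h2 x) = cint h1 + cint h2.
Proof.
move=> [r1 i1] [r2 i2]; rewrite /cint [RHS]/GRing.add /=; congr Complex.
  by rewrite -RintegralD//; apply: eq_Rintegral => x _; rewrite raddfD.
by rewrite -RintegralD//; apply: eq_Rintegral => x _; rewrite raddfD.
Qed.

Let ReM (c z : R[i]) : complex.Re (c * z) =
  complex.Re c * complex.Re z + (- complex.Im c) * complex.Im z.
Proof. by case: c z => [a b] [u v] /=; ring. Qed.

Let ImM (c z : R[i]) : complex.Im (c * z) =
  complex.Re c * complex.Im z + complex.Im c * complex.Re z.
Proof. by case: c z => [a b] [u v] /=; ring. Qed.

Lemma cintegrableZ c h : cintegrable h -> cintegrable (fun x => c * h x).
Proof.
move=> [r i]; split.
  apply: eq_integrable (integrableD measurableT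
    (integrableZl measurableT (complex.Re c) r)
    (integrableZl measurableT (- complex.Im c) i)) => // x _ /=.
  by rewrite -!EFinM -EFinD ReM.
apply: eq_integrable (integrableD measurableT
  (integrableZl measurableT (complex.Re c) i)
  (integrableZl measurableT (complex.Im c) r)) => // x _ /=.
by rewrite -!EFinM -EFinD ImM.
Qed.

Lemma cintZ c h : cintegrable h -> cint (fun x => c * h x) = c * cint h.
Proof.
move=> [r i].
have rZ k : mu.-integrable [set: D] (EFin \o (fun x => k * complex.Re (h x))).
  by apply: eq_integrable (integrableZl measurableT k r).
have iZ k : mu.-integrable [set: D] (EFin \o (fun x => k * complex.Im (h x))).
  by apply: eq_integrable (integrableZl measurableT k i).
apply/eqP; rewrite eq_complex ReM ImM /= -!RintegralZl// -!RintegralD//.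
by apply/andP; split; apply/eqP/eq_Rintegral => x _; rewrite ?ReM ?ImM.
Qed.

Lemma cintegrable0 : cintegrable (fun=> 0).
Proof. by split; exact: integrable0. Qed.

Lemma cint0 : cint (fun=> 0) = 0.
Proof. by rewrite /cint /Rintegral integral0. Qed.

Lemma cintegrable_sum (I : Type) (r : seq I) (h : I -> D -> R[i]) :
  (forall i, cintegrable (h i)) -> cintegrable (fun x => \sum_(i <- r) h i x).
Proof.
move=> ih; elim: r => [|i r IH].
  by under eq_fun do rewrite big_nil; exact: cintegrable0.
by under eq_fun do rewrite big_cons; exact: cintegrableD.
Qed.

Lemma cint_sum (I : Type) (r : seq I) (h : I -> D -> R[i]) :
  (forall i, cintegrable (h i)) ->
  cint (fun x => \sum_(i <- r) h i x) = \sum_(i <- r) cint (h i).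
Proof.
move=> ih; elim: r => [|i r IH].
  by under eq_fun do rewrite big_nil; rewrite cint0 big_nil.
under eq_fun do rewrite big_cons; rewrite cintD ?IH ?big_cons//.
exact: cintegrable_sum.
Qed.

Lemma integrable_sqr_normc f :
  mu.-integrable [set: D] (fun x => ((Normc.normc (f x)) ^+ 2)%:E).
Proof.
apply/integrableP; split.
  apply/measurable_EFinP/measurable_funX.
  by apply: cmeasurable_normc; exact: L2fun_cmeasurable.
under eq_integral do rewrite gee0_abs ?lee_fin ?sqr_ge0//.
rewrite -L2norm_sqr expe2 lte_mul_pinfty ?L2norm_ge0 ?L2fun_fin//.
by rewrite ge0_fin_numE ?L2norm_ge0 ?L2fun_fin.
Qed.

(** The real and imaginary parts are both dominated by [|f|^2 + |g|^2]. *)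
Lemma cintegrable_dot f g : cintegrable (fun x => (f x)^* * g x).
Proof.
have [mr mi] : cmeasurable (fun x => (f x)^* * g x).
  apply: cmeasurableM; last exact: L2fun_cmeasurable.
  by apply: cmeasurable_conj; exact: L2fun_cmeasurable.
have ifg := integrableD measurableT (integrable_sqr_normc f) (integrable_sqr_normc g).
split.
  apply: le_integrable ifg => //; first exact/measurable_EFinP.
  move=> x _ /=; rewrite lee_fin [leRHS]ger0_norm ?addr_ge0 ?sqr_ge0//.
  rewrite !sqr_normc; case: (f x) (g x) => [a b] [u v] /=.
  rewrite ler_norml; apply/andP; split.
    by have := sqr_ge0 (a + u); have := sqr_ge0 (b + v); nra.
  by have := sqr_ge0 (a - u); have := sqr_ge0 (b - v); nra.
apply: le_integrable ifg => //; first exact/measurable_EFinP.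
move=> x _ /=; rewrite lee_fin [leRHS]ger0_norm ?addr_ge0 ?sqr_ge0//.
rewrite !sqr_normc; case: (f x) (g x) => [a b] [u v] /=.
rewrite ler_norml; apply/andP; split.
  by have := sqr_ge0 (a + v); have := sqr_ge0 (b - u); nra.
by have := sqr_ge0 (a - v); have := sqr_ge0 (b + u); nra.
Qed.

Definition dot f g : R[i] := cint (fun x => (f x)^* * g x).

Lemma dotDr f g1 g2 : dot f (g1 + g2) = dot f g1 + dot f g2.
Proof.
rewrite /dot -cintD; [|exact: cintegrable_dot..].
by congr cint; apply/funext => x; rewrite -mulrDr.
Qed.

Lemma dotZr c f g : dot f (c *: g) = c * dot f g.
Proof.
rewrite /dot -cintZ; last exact: cintegrable_dot.
by congr cint; apply/funext => x; rewrite mulrCA.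
Qed.

Lemma dotC f g : dot g f = (dot f g)^*.
Proof.
rewrite /dot /cint [RHS]/=; congr Complex.
  by apply: eq_Rintegral => x _; case: (f x) (g x) => [a b] [u v] /=; ring.
rewrite -[RHS]mulN1r -RintegralZl//; last by have [] := cintegrable_dot f g.
by apply: eq_Rintegral => x _; case: (f x) (g x) => [a b] [u v] /=; ring.
Qed.

Lemma dot_sumr (I : Type) (r : seq I) f (c : I -> R[i]) (g : I -> L2fun mu) :
  dot f (\sum_(i <- r) c i *: g i) = \sum_(i <- r) c i * dot f (g i).
Proof.
elim: r => [|i r IH]; last by rewrite !big_cons dotDr dotZr IH.
by rewrite !big_nil -(scale0r 0) dotZr mul0r.
Qed.

Lemma dot_suml (I : Type) (r : seq I) f (c : I -> R[i]) (g : I -> L2fun mu) :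
  dot (\sum_(i <- r) c i *: g i) f = \sum_(i <- r) (c i)^* * dot (g i) f.
Proof.
rewrite dotC dot_sumr rmorph_sum; apply: eq_bigr => i _.
by rewrite rmorphM /= -dotC.
Qed.

Lemma dotDl f g1 g2 : dot (g1 + g2) f = dot g1 f + dot g2 f.
Proof. by rewrite dotC dotDr rmorphD /= -!dotC. Qed.

Lemma sqr_normL2 f :
  ((`|L2class f| ^+ 2)%:E = \int[mu]_x ((Normc.normc (f x)) ^+ 2)%:E)%E.
Proof. by rewrite EFin_expe normL2class L2norm_sqr. Qed.

Lemma dot_norm f : dot f f = (`|L2class f| ^+ 2)%:C%C.
Proof.
rewrite /dot /cint; congr Complex.
  apply: EFin_inj; rewrite sqr_normL2 fineK.
    apply: eq_integral => x _; rewrite sqr_normc.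
    by case: (f x) => a b /=; congr EFin; ring.
  by apply: integrable_fin_num => //; have [] := cintegrable_dot f f.
rewrite -[RHS](_ : \int[mu]_x 0 = 0); last by rewrite /Rintegral integral0.
by apply: eq_Rintegral => x _; case: (f x) => a b /=; ring.
Qed.

Lemma L2class_sum (I : Type) (r : seq I) (c : I -> R[i]) (g : I -> L2fun mu) :
  L2class (\sum_(i <- r) c i *: g i) = \sum_(i <- r) c i *: L2class (g i).
Proof.
elim: r => [|i r IH]; first by rewrite !big_nil L2class0.
by rewrite !big_cons L2classD IH scaleL2class.
Qed.

Definition orthonormalL2 n (phi : 'I_n -> L2fun mu) :=
  forall i j, dot (phi i) (phi j) = (i == j)%:R.

(** The form of the Gram matrix at [v] is the squared norm of the combination with coefficients [v],
    so linear independence makes it positive definite. The matrix [S] that reduces it to the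
    identity is an invertible change of basis, which keeps the span. *)
Lemma exists_orthonormal n (V : set (L2 mu)) : subspace_of_dim n V ->
  exists2 phi : 'I_n -> L2fun mu, orthonormalL2 phi &
    V = [set v | exists c : 'I_n -> R[i], v = \sum_i c i *: L2class (phi i)].
Proof.
move=> [b free_b VE]; pose B i : L2fun mu := repr (b i).
have BE i : L2class (B i) = b i by exact: L2class_repr.
pose G := \matrix_(i, j) dot (B i) (B j).
have qG v : qform G v = dot (\sum_i v i 0 *: B i) (\sum_i v i 0 *: B i).
  rewrite dot_suml /qform -mulmxA mxE; apply: eq_bigr => i _.
  rewrite !mxE dot_sumr; congr (_ * _); apply: eq_bigr => j _.
  by rewrite mxE mulrC.
have pG : pdmx G.
  split; first by apply/matrixP => i j; rewrite !mxE -dotC.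
  move=> v v0; rewrite qG dot_norm ltcR exprn_gt0// normr_gt0 L2class_sum.
  under eq_bigr do rewrite BE.
  apply: contra v0 => /eqP /free_b v0; apply/eqP/matrixP => i j.
  by rewrite ord1 mxE v0.
have [S uS SGS] := pdmx_cholesky pG.
exists (fun j => \sum_k S k j *: B k) => [i j|].
  have := congr1 (fun A : 'M[R[i]]_n => A i j) SGS; rewrite [RHS]mxE => <-.
  rewrite dot_suml -mulmxA mxE; apply: eq_bigr => k _.
  rewrite !mxE dot_sumr; congr (_ * _); apply: eq_bigr => l _.
  by rewrite mxE mulrC.
have spanE (c' : 'cV[R[i]]_n) : \sum_j c' j 0 *: L2class (\sum_k S k j *: B k) =
    \sum_k (S *m c') k 0 *: b k.
  under eq_bigr do rewrite L2class_sum scaler_sumr.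
  rewrite exchange_big; apply: eq_bigr => k _; rewrite mxE scaler_suml.
  by apply: eq_bigr => j _; rewrite scalerA BE mulrC.
rewrite VE; apply/seteqP; split=> v /= [c ->].
  pose cc : 'cV[R[i]]_n := \col_i c i.
  exists (fun j => (invmx S *m cc) j 0); rewrite spanE mulKVmx//.
  by apply: eq_bigr => i _; rewrite mxE.
pose cc : 'cV[R[i]]_n := \col_i c i.
exists (fun k => (S *m cc) k 0); rewrite -spanE.
by apply: eq_bigr => i _; rewrite mxE.
Qed.

(** * Orthogonal projection on the span of an orthonormal family *)

Section projection.
Variables (n : nat) (phi : 'I_n -> L2fun mu).
Hypothesis phi_on : orthonormalL2 phi.

Definition residual f : L2fun mu := f - \sum_j dot (phi j) f *: phi j.

Lemma dot_residual f j : dot (phi j) (residual f) = 0.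
Proof.
rewrite /residual -scaleN1r dotDr dotZr dot_sumr (bigD1 j)//= phi_on eqxx.
rewrite mulr1 big1 ?addr0 ?mulN1r ?subrr// => i ij.
by rewrite phi_on eq_sym (negPf ij) mulr0.
Qed.

(** The residual is orthogonal to every [phi j]. This yields both the optimality of the projection
    and the splitting of the error of a fit. *)
Lemma pythagoras f (c : 'I_n -> R[i]) :
  `|L2class (residual f + \sum_j c j *: phi j)| ^+ 2 =
  `|L2class (residual f)| ^+ 2 + \sum_j (Normc.normc (c j)) ^+ 2.
Proof.
apply: complexI; rewrite rmorphD /= -!dot_norm dotDl.
rewrite !(dotDr _ (residual f)) -addrA; congr (_ + _).
have rs : dot (residual f) (\sum_j c j *: phi j) = 0.
  by rewrite dot_sumr big1// => j _; rewrite dotC dot_residual rmorph0 mulr0.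
rewrite rs (dotC (residual f)) rs rmorph0 !add0r rmorph_sum /=.
rewrite dot_suml; apply: eq_bigr => i _.
rewrite dot_sumr (bigD1 i)//= phi_on eqxx mulr1 big1 ?addr0.
  by rewrite mulrC -normCK normr_normc rmorphXn.
by move=> j ij; rewrite phi_on eq_sym (negPf ij) mulr0.
Qed.

Lemma L2class_sub_comb f (c : 'I_n -> R[i]) :
  L2class f - \sum_j c j *: L2class (phi j) =
  L2class (residual f + \sum_j (dot (phi j) f - c j) *: phi j).
Proof.
rewrite -L2class_sum -scaleN1r scaleL2class -L2classD; congr L2class.
rewrite scaleN1r /residual -addrA; congr (_ + _).
rewrite addrC -sumrB -sumrN; apply: eq_bigr => j _.
by rewrite scalerBl addrAC subrr add0r.
Qed.

Lemma best_approximation_residual V f :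
  V = [set v | exists c : 'I_n -> R[i], v = \sum_i c i *: L2class (phi i)] ->
  best_approximation V (L2class f) (\sum_j dot (phi j) f *: L2class (phi j)) /\
  L2class f - \sum_j dot (phi j) f *: L2class (phi j) = L2class (residual f).
Proof.
move=> VE.
have resE : L2class f - \sum_j dot (phi j) f *: L2class (phi j) = L2class (residual f).
  rewrite L2class_sub_comb big1 ?addr0// => j _.
  by rewrite subrr scale0r.
split=> //; split; first by rewrite VE; exists (fun j => dot (phi j) f).
move=> w; rewrite VE resE => -[c ->]; rewrite L2class_sub_comb.
rewrite -ler_sqr ?nnegrE// pythagoras lerDl.
by apply: sumr_ge0 => j _; rewrite sqr_ge0.
Qed.

(* Conjugated, so that (frame x)^* a is the value at x of the combination of the
   phi j with coefficients a. *)
Definition frame (x : D) : 'cV[R[i]]_n := \col_j (phi j x)^*.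

Lemma mxmeasurable_frame : mxmeasurable frame.
Proof.
move=> i j; under eq_fun do rewrite mxE.
by apply: cmeasurable_conj; exact: L2fun_cmeasurable.
Qed.

(** Orthonormality says that the outer products of [frame x] with itself integrate to the identity.
    Trace bounds on [barrier_mx] thus become integral bounds. *)
Lemma cint_qform_frame (N : 'M[R[i]]_n) :
  cintegrable (fun x => qform N (frame x)) /\
  cint (fun x => qform N (frame x)) = \tr N.
Proof.
have qE x : qform N (frame x) = \sum_i \sum_j N i j * ((phi j x)^* * phi i x).
  rewrite /qform -mulmxA mxE; apply: eq_bigr => i _.
  rewrite !mxE conjCK mulr_sumr; apply: eq_bigr => j _.
  by rewrite !mxE; ring.
have iN i : cintegrable (fun x => \sum_j N i j * ((phi j x)^* * phi i x)).
  apply: cintegrable_sum => j; apply: cintegrableZ; exact: cintegrable_dot.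
split; first by under eq_fun do rewrite qE; exact: cintegrable_sum.
under eq_fun do rewrite qE; rewrite cint_sum//; apply: eq_bigr => i _.
rewrite cint_sum => [|j]; last by apply: cintegrableZ; exact: cintegrable_dot.
rewrite (bigD1 i)//= cintZ ?big1 ?addr0; last exact: cintegrable_dot.
  by rewrite -/(dot (phi i) (phi i)) phi_on eqxx mulr1.
move=> j ji; rewrite cintZ; last exact: cintegrable_dot.
by rewrite -/(dot (phi j) (phi i)) phi_on (negPf ji) mulr0.
Qed.

Lemma eval_span (c : 'I_n -> R[i]) x :
  (\sum_j c j *: phi j : L2fun mu) x = ((frame x)^t* *m \col_j c j) 0 0.
Proof.
rewrite mxE; under [RHS]eq_bigr do rewrite !mxE conjCK.
rewrite (big_morph (fun f : L2fun mu => f x) (id1 := 0) (op1 := +%R)) //.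
by apply: eq_bigr => j _; rewrite mulrC.
Qed.

End projection.
End cint.

(** * The weighted walk *)

Section sampler.
Context {d} {D : measurableType d} {R : realType} {n : nat}.
Variables (v : D -> 'cV[R[i]]_n).
Hypotheses (n0 : (0 < n)%N) (mv : mxmeasurable v).

(** The positive part of [L]. The real part makes it defined for every [M]; on the matrices of a
    good walk the form is real. *)
Definition gain (M : 'M[R[i]]_n) (x : D) : R :=
  Num.max 0 (complex.Re (qform (barrier_mx M) (v x))).

(* In a history of draws the latest point comes first. After k draws, walk is the
   weighted sum of the matrices v(x) v(x)^* minus (k - 2n) times the identity. *)
Fixpoint walk (s : seq D) : 'M[R[i]]_n :=
  if s is x :: s' then
    walk s' - 1%:M + (gain (walk s') x)^-1%:C%C *: (v x *m (v x)^t*)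
  else ((2 * n)%:R)%:M.

(* Almost sure under the sampling law; elsewhere 0^-1 = 0 makes walk junk. *)
Fixpoint good (s : seq D) : bool :=
  if s is x :: s' then good s' && (0 < gain (walk s') x) else true.

(** The value 0 after a bad history lets the bound on expected weights hold whatever the past. *)
Definition weight (s : seq D) (x : D) : R :=
  if good s then (gain (walk s) x)^-1 else 0.

Lemma gain_ge0 M x : 0 <= gain M x.
Proof. by rewrite le_max lexx. Qed.

Lemma weight_ge0 s x : 0 <= weight s x.
Proof. by rewrite /weight; case: ifP; rewrite // invr_ge0 gain_ge0. Qed.

Lemma qform_barrier_real M x : pdmx M -> \tr (invmx M) = 2^-1 ->
  qform (barrier_mx M) (v x) = (complex.Re (qform (barrier_mx M) (v x)))%:C%C.
Proof.
move=> pM trM; have := qformC (barrier_mx M) (v x).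
rewrite barrier_mx_herm//; case: qform => a b [] /= /eqP.
by rewrite eq_sym -addr_eq0 -mulr2n mulrn_eq0 /= => /eqP ->.
Qed.

(** The invariant of the walk: a positive [gain] is [L] itself, so its inverse is the weight of the
    barrier step. *)
Lemma good_walk s : good s ->
  pdmx (walk s) /\ \tr (invmx (walk s)) = 2^-1.
Proof.
elim: s => [_|x s IH] /=.
  have c0 : 0 < (2 * n)%:R :> R[i] by rewrite ltr0n muln_gt0.
  split.
    split; first by rewrite trmxC_scalar rmorph_nat.
    by move=> u u0; rewrite -scalemx1 qformZ mulr_gt0 ?qform1_gt0.
  (* The inverse has [n] diagonal entries [1 / (2n)], hence the starting multiple [2n]. *)
  rewrite invmx_scalar mxtrace_scalar -mulr_natl natrM.
  by field; rewrite pnatr_eq0 -lt0n n0.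
move=> /andP[/IH[pM trM] g0].
have b0 : 0 < qform (barrier_mx (walk s)) (v x).
  by move: g0; rewrite qform_barrier_real// ltcR lt_max ltxx.
have -> : (gain (walk s) x)^-1%:C%C = (qform (barrier_mx (walk s)) (v x))^-1.
  rewrite fmorphV /= [in RHS]qform_barrier_real//; congr (_%:C%C)^-1.
  by apply/max_idPr/ltW; move: b0; rewrite qform_barrier_real// ltcR.
by split; [exact: barrier_step_pd|exact: barrier_step_trace].
Qed.

(** With the latest draw first, the past of the draw at position [i] is what follows that
    position. *)
Definition wt k (s : k.-tuple D) (i : 'I_k) : R :=
  weight (drop i.+1 s) (tnth s i).

Lemma wt_ge0 k (s : k.-tuple D) i : 0 <= wt s i.
Proof. exact: weight_ge0. Qed.

Lemma wt0 k x (s : k.-tuple D) : wt [tuple of x :: s] ord0 = weight s x.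
Proof. by rewrite /wt tnth0 /= drop0. Qed.

Lemma wtS k x (s : k.-tuple D) i : wt [tuple of x :: s] (lift ord0 i) = wt s i.
Proof. by rewrite /wt tnthS. Qed.

Lemma sum_wtS (V : nmodType) (F : R -> D -> V) k x (s : k.-tuple D) :
  let s' := [tuple of x :: s] in
  \sum_i F (wt s' i) (tnth s' i) = F (weight s x) x + \sum_i F (wt s i) (tnth s i).
Proof.
rewrite /= big_ord_recl wt0 tnth0; congr (_ + _).
by apply: eq_bigr => i _; rewrite wtS tnthS.
Qed.

(** The recursion unrolled. Goodness matters because after a bad history [weight] is 0 while [walk]
    still adds the inverse of [gain]. *)
Lemma walkE k (s : k.-tuple D) : good s ->
  walk s + (k%:R)%:M = ((2 * n)%:R)%:M +
    \sum_i (wt s i)%:C%C *: (v (tnth s i) *m (v (tnth s i))^t*).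
Proof.
elim: k s => [s|k IH s].
  by rewrite tuple0 big_ord0 /= -(raddfD (@scalar_mx _ _)) /= !addr0.
case/tupleP: s => x s /= /andP[gs _].
rewrite (sum_wtS (fun w y => w%:C%C *: (v y *m (v y)^t*))) addrCA -IH//.
rewrite /weight gs -natr1 raddfD /= [_ + _%:C%C *: _]addrC -!addrA; congr (_ + (_ + _)).
by rewrite [X in - _ + X]addrC addKr.
Qed.

(** * Measurability of the walk and of its weights *)

Section measurability.
Context {d'} {T : measurableType d'}.

Lemma cmeasurable_comp d2 (T2 : measurableType d2) (h : T2 -> R[i]) (f : T -> T2) :
  cmeasurable h -> measurable_fun [set: T] f -> cmeasurable (fun t => h (f t)).
Proof.
move=> [mr mi] mf.
by split; [exact: (measurableT_comp mr mf)|exact: (measurableT_comp mi mf)].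
Qed.

Lemma mxmeasurable_comp d2 (T2 : measurableType d2) p q
    (A : T2 -> 'M[R[i]]_(p, q)) (f : T -> T2) :
  mxmeasurable A -> measurable_fun [set: T] f -> mxmeasurable (A \o f).
Proof. by move=> mA mf i j; exact: cmeasurable_comp (mA i j) mf. Qed.

Lemma measurable_gain (A : T -> 'M[R[i]]_n) (f : T -> D) :
  mxmeasurable A -> measurable_fun [set: T] f ->
  measurable_fun [set: T] (fun t => gain (A t) (f t)).
Proof.
move=> mA mf; apply: measurable_maxr; first exact: measurable_cst.
suff [] : cmeasurable (fun t => qform (barrier_mx (A t)) (v (f t))) by [].
apply: cmeasurable_qform; last exact: (mxmeasurable_comp mv mf).
have mN (B C : T -> 'M[R[i]]_n) : mxmeasurable B -> mxmeasurable C ->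
    mxmeasurable (fun t => B t - C t).
  move=> mB mC; under eq_fun do rewrite -scaleN1r.
  apply: mxmeasurableD => //; apply: mxmeasurableZ => //; exact: cmeasurable_cst.
have ma : mxmeasurable (fun t => invmx (A t - 1%:M)).
  by apply: mxmeasurable_inv; apply: mN => //; exact: mxmeasurable_cst.
apply: (mN) => //; apply: mxmeasurableZ; last exact: mxmeasurable_mul.
apply: cmeasurable_inv; apply: cmeasurableD; first exact: cmeasurable_tr.
by apply: cmeasurableN; apply: cmeasurable_tr; exact: mxmeasurable_inv.
Qed.

End measurability.

Lemma mxmeasurable_walk k : mxmeasurable (fun s : k.-tuple D => walk s).
Proof.
elim: k => [|k IH].
  rewrite (_ : (fun _ => _) = fun=> walk [::]); first exact: mxmeasurable_cst.
  by apply/funext => s; rewrite tuple0.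
have mh : measurable_fun [set: k.+1.-tuple D] (fun s => thead s) by exact: measurable_tnth.
have mt := @measurable_behead _ D k.
rewrite (_ : (fun _ => _) = fun s : k.+1.-tuple D =>
    walk [tuple of behead s] - 1%:M +
    (gain (walk [tuple of behead s]) (thead s))^-1%:C%C *:
      (v (thead s) *m (v (thead s))^t*)); last first.
  by apply/funext => s; rewrite {1}(tuple_eta s).
have mw := mxmeasurable_comp IH mt.
apply: mxmeasurableD; first by apply: mxmeasurableD => //; exact: mxmeasurable_cst.
apply: mxmeasurableZ.
  apply: cmeasurable_real; apply: measurable_invr_ge0 => [s|]; first exact: gain_ge0.
  exact: measurable_gain.
apply: mxmeasurable_mul; first exact: (mxmeasurable_comp mv mh).
by apply: mxmeasurable_trC; exact: (mxmeasurable_comp mv mh).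
Qed.

Lemma measurable_good k : measurable_fun [set: k.-tuple D] (fun s => good s).
Proof.
elim: k => [|k IH].
  rewrite (_ : (fun _ => _) = cst true); first exact: measurable_cst.
  by apply/funext => s; rewrite tuple0.
have mh : measurable_fun [set: k.+1.-tuple D] (fun s => thead s) by exact: measurable_tnth.
have mt := @measurable_behead _ D k.
rewrite (_ : (fun _ => _) = fun s : k.+1.-tuple D => good [tuple of behead s] &&
    (0 < gain (walk [tuple of behead s]) (thead s))); last first.
  by apply/funext => s; rewrite {1}(tuple_eta s).
apply: measurable_and; first exact: (measurableT_comp IH mt).
apply: measurable_fun_ltr; first exact: measurable_cst.
by apply: measurable_gain => //; exact: (mxmeasurable_comp (@mxmeasurable_walk k) mt).
Qed.

Lemma measurable_weight d' (T : measurableType d') k (f : T -> k.-tuple D) (g : T -> D) :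
  measurable_fun [set: T] f -> measurable_fun [set: T] g ->
  measurable_fun [set: T] (fun t => weight (f t) (g t)).
Proof.
move=> mf mg; apply: measurable_fun_ifT; last exact: measurable_cst.
  exact: (measurableT_comp (@measurable_good k) mf).
apply: measurable_invr_ge0 => [t|]; first exact: gain_ge0.
by apply: measurable_gain => //; exact: (mxmeasurable_comp (@mxmeasurable_walk k) mf).
Qed.

Lemma measurable_wt k (i : 'I_k) : measurable_fun [set: k.-tuple D] (fun s => wt s i).
Proof.
elim: k i => [[]//|k IH] i.
have mh : measurable_fun [set: k.+1.-tuple D] (fun s => thead s) by exact: measurable_tnth.
have mt := @measurable_behead _ D k.
case: (unliftP ord0 i) => [j|] ->.
  rewrite (_ : (fun _ => _) = fun s : k.+1.-tuple D => wt [tuple of behead s] j).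
    exact: (measurableT_comp (IH j) mt).
  by apply/funext => s; rewrite {1}(tuple_eta s) wtS.
rewrite (_ : (fun _ => _) = fun s : k.+1.-tuple D => weight [tuple of behead s] (thead s)).
  exact: (measurable_weight mt).
by apply/funext => s; rewrite {1}(tuple_eta s) wt0.
Qed.

End sampler.

(** * The random sample *)

Section random_walk.
Context {d} {D : measurableType d} {R : realType} {mu : {measure set D -> \bar R}}.
Context {n : nat} {phi : 'I_n -> L2fun mu}.
Hypotheses (n0 : (0 < n)%N) (phi_on : orthonormalL2 phi).
Let v := frame phi.
Let mv : mxmeasurable v := mxmeasurable_frame phi.

Let mgain (M : 'M[R[i]]_n) : measurable_fun [set: D] (gain v M).
Proof.
have mM : mxmeasurable (fun _ : D => M) by exact: mxmeasurable_cst.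
have := measurable_gain mv mM. apply; exact: measurable_id.
Qed.

(** [gain] dominates the barrier form, whose integral is the trace of [barrier_mx]. *)
Lemma integral_gain_ge s : good v s ->
  ((2^-1)%:E <= \int[mu]_x (gain v (walk v s) x)%:E)%E.
Proof.
move=> gs; have [pM trM] := good_walk n0 gs.
have [[ir _] tr] := cint_qform_frame phi_on (barrier_mx (walk v s)).
have := barrier_mx_trace_ge n0 pM trM; rewrite -tr lecE => /andP[_ h].
apply: (@le_trans _ _ (\int[mu]_x (complex.Re (qform (barrier_mx (walk v s)) (v x)))%:E)%E).
  rewrite -[leRHS]fineK; last exact: integrable_fin_num.
  rewrite lee_fin; apply: le_trans h.
  have -> : (2^-1 : R[i]) = (2^-1)%:C%C by rewrite fmorphV /= rmorph_nat.
  by [].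
apply: le_integral => //.
  apply: le_integrable ir => //; first exact/measurable_EFinP.
  move=> x _ /=; rewrite lee_fin ger0_norm ?gain_ge0// /gain.
  by rewrite ge_max normr_ge0 ler_norm.
by move=> x _; rewrite lee_fin le_max lexx orbT.
Qed.

Lemma integral_gain_fin M : (\int[mu]_x (gain v M x)%:E < +oo)%E.
Proof.
have [[ir _] _] := cint_qform_frame phi_on (barrier_mx M).
have /integrableP[_] : mu.-integrable [set: D] (fun x => (gain v M x)%:E).
  apply: le_integrable ir => //; first exact/measurable_EFinP.
  move=> x _ /=; rewrite lee_fin ger0_norm ?gain_ge0// /gain.
  by rewrite ge_max normr_ge0 ler_norm.
by under eq_integral do rewrite gee0_abs ?lee_fin ?gain_ge0//.
Qed.

(* mu need not be sigma-finite: Fubini is applied to the probability measure of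
   density christoffel, with respect to which all the draws have a density. *)
Definition christoffel (x : D) : R := (\sum_j Normc.normc (phi j x) ^+ 2) / n%:R.

Lemma christoffel_ge0 x : 0 <= christoffel x.
Proof. by rewrite mulr_ge0 ?invr_ge0//; apply: sumr_ge0 => j _; rewrite sqr_ge0. Qed.

Let mphi j : measurable_fun [set: D] (fun x => Normc.normc (phi j x) ^+ 2).
Proof.
by apply/measurable_funX/cmeasurable_normc; exact: L2fun_cmeasurable.
Qed.

Lemma measurable_christoffel : measurable_fun [set: D] christoffel.
Proof. by apply: measurable_funM => //; exact: measurable_sum. Qed.

Lemma integral_christoffel : (\int[mu]_x (christoffel x)%:E = 1)%E.
Proof.
under eq_integral do rewrite /christoffel mulrC EFinM.
rewrite ge0_integralZl//; last 2 first.
- by apply/measurable_EFinP; exact: measurable_sum.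
- by move=> x _; rewrite lee_fin sumr_ge0// => j _; rewrite sqr_ge0.
under eq_integral do rewrite -sumEFin.
rewrite ge0_integral_sum//; last 2 first.
- by move=> j; exact/measurable_EFinP.
- by move=> j x _; rewrite lee_fin sqr_ge0.
under eq_bigr => j _.
  rewrite -sqr_normL2.
  have -> : `|L2class (phi j)| ^+ 2 = 1.
    by apply: complexI; rewrite -dot_norm phi_on eqxx.
  over.
by rewrite sumEFin sumr_const card_ord -EFinM mulVf// pnatr_eq0 -lt0n.
Qed.

(** Where [christoffel] vanishes, all [phi j] vanish, hence so does [gain]. *)
Lemma gain_christoffel M x : gain v M x / christoffel x * christoffel x = gain v M x.
Proof.
have [k0|k0] := eqVneq (christoffel x) 0; last by rewrite divfK.
rewrite k0 mulr0; suff v0 : v x = 0.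
  by rewrite /gain v0 /qform mulmx0 mxE raddf0 maxxx.
apply/matrixP => j i; rewrite !mxE.
move/eqP: k0; rewrite mulf_eq0 invr_eq0 pnatr_eq0 -[n == 0]negbK -lt0n n0 orbF.
rewrite psumr_eq0 => [/allP/(_ j (mem_index_enum _))|k _]; last by rewrite sqr_ge0.
by rewrite /= sqrf_eq0 => /eqP/Normc.eq0_normc ->; rewrite rmorph0.
Qed.

Lemma exists_christoffel_probability : exists rho : probability D R,
  forall F : D -> \bar R, (forall x, 0 <= F x)%E -> measurable_fun [set: D] F ->
    (\int[rho]_x F x = \int[mu]_x (F x * (christoffel x)%:E))%E.
Proof.
pose nu := density mu christoffel_ge0 measurable_christoffel.
have nu1 : nu setT = 1%E by exact: integral_christoffel.
pose m := Measure_isProbability.Build _ _ _ nu nu1.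
pose Q : probability D R := HB.pack nu m.
by exists Q => F F0 mF; exact: integral_density.
Qed.

(** * One more draw, conditional on the past *)

Section step.
Variables (k : nat) (P : probability (k.-tuple D) R) (rho : probability D R).
Hypothesis rhoE : forall F : D -> \bar R,
  (forall x, 0 <= F x)%E -> measurable_fun [set: D] F ->
  (\int[rho]_x F x = \int[mu]_x (F x * (christoffel x)%:E))%E.

(** The density with respect to [rho] of the measure with density [gain] with respect to [mu]; [Z]
    is its total mass. *)
Let h (z : k.-tuple D * D) : R := gain v (walk v z.1) z.2 / christoffel z.2.
Let Z (s : k.-tuple D) : R := fine (\int[rho]_x (h (s, x))%:E).
(** After a bad history the next point is drawn from [rho] itself, so that [q] is a probability
    density for every past. *)
Let q (z : k.-tuple D * D) : R := if good v z.1 then (Z z.1)^-1 * h z else 1.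

Let h_ge0 z : 0 <= h z.
Proof. by rewrite mulr_ge0 ?gain_ge0// invr_ge0 christoffel_ge0. Qed.

Let mh : measurable_fun [set: k.-tuple D * D] h.
Proof.
apply: measurable_funM.
  apply: (measurable_gain mv) => //.
  have mw := @mxmeasurable_walk _ _ _ _ _ mv k.
  exact: (mxmeasurable_comp mw measurable_fst).
apply: measurable_invr_ge0 => [z|]; first exact: christoffel_ge0.
exact: (measurableT_comp measurable_christoffel).
Qed.

Let mZ : measurable_fun [set: k.-tuple D] Z.
Proof.
apply: (measurableT_comp (f := fine)) => //.
apply: (measurable_fun_fubini_tonelli_F (fun z => (h z)%:E)); last first.
  by move=> z; rewrite lee_fin.
exact/measurable_EFinP.
Qed.

Let Z_ge0 s : 0 <= Z s.
Proof. by rewrite fine_ge0// integral_ge0// => x _; rewrite lee_fin. Qed.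

Let q_ge0 z : 0 <= q z.
Proof. by rewrite /q; case: ifP => // _; rewrite mulr_ge0 ?invr_ge0. Qed.

Let mq : measurable_fun [set: k.-tuple D * D] q.
Proof.
apply: measurable_fun_ifT => //.
  exact: (measurableT_comp (@measurable_good _ _ _ _ _ mv k)).
apply: measurable_funM => //; apply: (measurableT_comp (f := fun s => (Z s)^-1)) => //.
exact: measurable_invr_ge0.
Qed.

Let rho_h s (f : D -> \bar R) : (forall x, 0 <= f x)%E -> measurable_fun [set: D] f ->
  (\int[rho]_x (f x * (h (s, x))%:E) = \int[mu]_x (f x * (gain v (walk v s) x)%:E))%E.
Proof.
move=> f0 mf; rewrite rhoE.
- by apply: eq_integral => x _; rewrite -muleA -EFinM gain_christoffel.
- by move=> x; rewrite mule_ge0 ?lee_fin.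
- apply: emeasurable_funM => //; apply/measurable_EFinP.
  exact: (measurableT_comp mh).
Qed.

Let ZE s : (\int[rho]_x (h (s, x))%:E = \int[mu]_x (gain v (walk v s) x)%:E)%E.
Proof.
transitivity (\int[rho]_x (1 * (h (s, x))%:E))%E.
  by apply: eq_integral => x _; rewrite mul1e.
rewrite (@rho_h s (fun=> 1%E))//.
by apply: eq_integral => x _; rewrite mul1e.
Qed.

Let Z_EFin s : (\int[rho]_x (h (s, x))%:E = (Z s)%:E)%E.
Proof.
rewrite /Z fineK// ge0_fin_numE; first by rewrite ZE integral_gain_fin.
by apply: integral_ge0 => x _; rewrite lee_fin.
Qed.

Let Z_ge (s : k.-tuple D) : good v s -> 2^-1 <= Z s.
Proof. by move=> gs; rewrite -lee_fin -Z_EFin ZE integral_gain_ge. Qed.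

Let q_good (s : k.-tuple D) (f : D -> \bar R) : good v s ->
  (forall x, 0 <= f x)%E -> measurable_fun [set: D] f ->
  (\int[rho]_x (f x * (q (s, x))%:E) =
   (Z s)^-1%:E * \int[mu]_x (f x * (gain v (walk v s) x)%:E))%E.
Proof.
move=> gs f0 mf; rewrite -rho_h//.
rewrite -ge0_integralZl//; last 3 first.
- apply: emeasurable_funM => //; apply/measurable_EFinP.
  exact: (measurableT_comp mh).
- by move=> x _; rewrite mule_ge0 ?lee_fin.
- by rewrite lee_fin invr_ge0.
by apply: eq_integral => x _; rewrite /q gs EFinM muleCA.
Qed.

Let q1 (s : k.-tuple D) : (\int[rho]_x (q (s, x))%:E = 1)%E.
Proof.
case/boolP: (good v s) => gs; last first.
  under eq_integral do rewrite /q (negPf gs).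
  by rewrite integral_cst// mul1e; exact: probability_setT.
transitivity (\int[rho]_x (1 * (q (s, x))%:E))%E.
  by apply: eq_integral => x _; rewrite mul1e.
rewrite (@q_good s (fun=> 1%E))//.
under eq_integral do rewrite mul1e.
rewrite -ZE Z_EFin -EFinM mulVf// gt_eqF//.
by apply: lt_le_trans (Z_ge gs); rewrite invr_gt0.
Qed.

Let consT (z : k.-tuple D * D) : k.+1.-tuple D := [tuple of z.2 :: z.1].

Let mcons : measurable_fun [set: k.-tuple D * D] consT.
Proof. exact: measurable_cons. Qed.

(** The new law is the image under [consT] of the joint law of a past and a point drawn with density
    [q]. Each draw adds at most [2 \int f] to the expected weighted sum. *)
Lemma walk_step :
  (\int[P]_s (if good v s then 0 else 1)%:E = 0)%E ->
  (forall f : D -> R, (forall x, 0 <= f x) -> measurable_fun [set: D] f ->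
    (\int[P]_s (\sum_i wt v s i * f (tnth s i))%:E <=
     (2 * k)%:R%:E * \int[mu]_x (f x)%:E)%E) ->
  exists P' : probability (k.+1.-tuple D) R,
  (\int[P']_s (if good v s then 0 else 1)%:E = 0)%E /\
  (forall f : D -> R, (forall x, 0 <= f x) -> measurable_fun [set: D] f ->
    (\int[P']_s (\sum_i wt v s i * f (tnth s i))%:E <=
     (2 * k.+1)%:R%:E * \int[mu]_x (f x)%:E)%E).
Proof.
move=> bad0 wb; have [Q QE] := draw P q_ge0 mq q1.
pose c : {mfun (k.-tuple D * D)%type >-> k.+1.-tuple D} := mfun_Sub (mem_set mcons).
pose P' : probability (k.+1.-tuple D) R := distribution Q c.
have P'E F : (forall s, 0 <= F s)%E -> measurable_fun [set: k.+1.-tuple D] F ->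
    (\int[P']_s F s = \int[P]_s \int[rho]_x (F [tuple of x :: s] * (q (s, x))%:E))%E.
  move=> F0 mF; rewrite ge0_integral_pushforward//= QE//.
  exact: (measurableT_comp mF).
pose W (s : k.-tuple D) f : R := \sum_i wt v s i * f (tnth s i).
have msum j (f : D -> R) : measurable_fun [set: D] f ->
    measurable_fun [set: j.-tuple D] (fun s => \sum_i wt v s i * f (tnth s i)).
  move=> mf; apply: measurable_sum => i; apply: measurable_funM.
    exact: measurable_wt.
  by apply: (measurableT_comp mf); exact: measurable_tnth.
have sum_ge0 j (f : D -> R) (s : j.-tuple D) : (forall x, 0 <= f x) ->
    0 <= \sum_i wt v s i * f (tnth s i).
  by move=> f0; apply: sumr_ge0 => i _; rewrite mulr_ge0// wt_ge0.
have mconss (s : k.-tuple D) : measurable_fun [set: D] (fun x => [tuple of x :: s]).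
  by apply: measurable_cons => //; exact: measurable_id.
have mqs s : measurable_fun [set: D] (fun x => q (s, x)).
  exact: (measurableT_comp mq).
exists P'; split.
  pose F j (s : j.-tuple D) : R := if good v s then 0 else 1.
  have mF j : measurable_fun [set: j.-tuple D] (F j).
    by apply: measurable_fun_ifT => //; exact: measurable_good.
  rewrite P'E; last 2 first.
  - by move=> s; rewrite lee_fin; case: ifP.
  - by apply/measurable_EFinP; exact: (mF k.+1).
  rewrite -[RHS]bad0; apply: eq_integral => s _.
  case: ifPn => gs; last first.
    rewrite -[RHS](q1 s); apply: eq_integral => x _.
    by rewrite /= (negPf gs) mul1e.
  rewrite (q_good gs); last 2 first.
  - by move=> x; rewrite lee_fin; case: ifP.
  - exact/measurable_EFinP/(measurableT_comp (mF k.+1)).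
  (* A good past is continued badly only where [gain] is 0, and there the density of the draw is 0
     too. *)
  rewrite integral0_eq ?mule0// => x _ /=; rewrite gs /=.
  by case: ltP => [|g0]; rewrite ?mul0e// mul1e; congr EFin;
    apply/eqP; rewrite eq_le g0 gain_ge0.
move=> f f0 mf; set I := (\int[mu]_x (f x)%:E)%E.
have I0 : (0 <= I)%E by apply: integral_ge0 => x _; rewrite lee_fin.
rewrite P'E; last 2 first.
- by move=> s; rewrite lee_fin sum_ge0.
- by apply/measurable_EFinP; exact: (msum _ f mf).
have wf0 s x : 0 <= weight v s x * f x by rewrite mulr_ge0 ?weight_ge0.
have mwf (s : k.-tuple D) : measurable_fun [set: D] (fun x => weight v s x * f x).
  apply: measurable_funM => //.
  have mcs : measurable_fun [set: D] (fun=> s) by exact: measurable_cst.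
  by have := measurable_weight mv mcs; apply; exact: measurable_id.
(* The expectation of the new term given [s]: the weight cancels [gain] in the density, and the
   normalization [Z^-1] is at most 2. *)
have inner (s : k.-tuple D) :
    (\int[rho]_x ((weight v s x * f x)%:E * (q (s, x))%:E) <= 2%:E * I)%E.
  case/boolP: (good v s) => gs; last first.
    rewrite integral0_eq ?mule_ge0// => x _.
    by rewrite /weight (negPf gs) mul0r mul0e.
  rewrite (q_good gs); last 2 first.
  - by move=> x; rewrite lee_fin.
  - exact/measurable_EFinP.
  apply: lee_pmul.
  - by rewrite lee_fin invr_ge0.
  - by apply: integral_ge0 => x _; rewrite mule_ge0 ?lee_fin ?gain_ge0.
  - rewrite lee_fin -[leRHS]invrK lef_pV2 ?Z_ge// posrE ?invr_gt0//.
    by apply: lt_le_trans (Z_ge gs); rewrite invr_gt0.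
  apply: ge0_le_integral => //.
  - by move=> x _; rewrite mule_ge0 ?lee_fin ?gain_ge0.
  - by apply: emeasurable_funM; exact/measurable_EFinP.
  - exact/measurable_EFinP.
  move=> x _; rewrite -EFinM lee_fin /weight gs mulrAC.
  (* Where [gain] is 0 the product of weight and gain is 0, not 1, so there is only an
     inequality. *)
  have [->|g0] := eqVneq (gain v (walk v s) x) 0; first by rewrite mulr0 mul0r.
  by rewrite mulVf// mul1r.
apply: (@le_trans _ _ (\int[P]_s (2%:E * I + (W s f)%:E))%E).
  apply: ge0_le_integral => //.
  - move=> s _; apply: integral_ge0 => x _.
    by rewrite mule_ge0 ?lee_fin ?sum_ge0.
  - apply: (measurable_fun_fubini_tonelli_F (fun z : k.-tuple D * D =>
      (\sum_i wt v (consT z) i * f (tnth (consT z) i))%:E * (q z)%:E)%E).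
      apply: emeasurable_funM; last exact/measurable_EFinP.
      by apply/measurable_EFinP; exact: (measurableT_comp (msum k.+1 f mf)).
    by move=> z; rewrite mule_ge0 ?lee_fin ?sum_ge0.
  - apply: emeasurable_funD; first exact: measurable_cst.
    by apply/measurable_EFinP; exact: (msum _ f mf).
  move=> s _.
  under eq_integral => x _.
    rewrite (sum_wtS v (fun w y => w * f y)) -/(W s f) EFinD.
    rewrite ge0_muleDl ?lee_fin ?sum_ge0//; over.
  rewrite ge0_integralD//=; last 4 first.
  - by move=> x _; rewrite mule_ge0 ?lee_fin.
  - by apply: emeasurable_funM; exact/measurable_EFinP.
  - by move=> x _; rewrite mule_ge0 ?lee_fin ?sum_ge0.
  - by apply: emeasurable_funM => //; exact/measurable_EFinP.
  apply: leeD => //; rewrite ge0_integralZl//= ?q1 ?mule1// ?lee_fin ?sum_ge0//.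
    exact/measurable_EFinP.
  by move=> x _; rewrite lee_fin.
rewrite ge0_integralD//=; last 3 first.
- by move=> s _; rewrite mule_ge0.
- by move=> s _; rewrite lee_fin sum_ge0.
- by apply/measurable_EFinP; exact: (msum _ f mf).
have -> : (\int[P]_s (2%:E * I) = 2%:E * I)%E.
  rewrite integral_cst// -[RHS]mule1; congr (_ * _)%E.
  exact: probability_setT.
rewrite mulnS natrD [X in (_ <= X * _)%E]EFinD [leRHS]ge0_muleDl ?lee_fin//.
by apply: leeD => //; exact: wb.
Qed.

End step.

(** The induction starts from the Dirac mass at the empty history. Both properties are integrals of
    nonnegative functions, the form in which [draw] describes the next law. *)
Lemma exists_walk k : exists P : probability (k.-tuple D) R,
  (\int[P]_s (if good v s then 0 else 1)%:E = 0)%E /\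
  (forall f : D -> R, (forall x, 0 <= f x) -> measurable_fun [set: D] f ->
    (\int[P]_s (\sum_i wt v s i * f (tnth s i))%:E <=
     (2 * k)%:R%:E * \int[mu]_x (f x)%:E)%E).
Proof.
have [rho rhoE] := exists_christoffel_probability.
elim: k => [|k [P [bad0 wb]]]; last exact: walk_step rhoE bad0 wb.
pose P : probability (0.-tuple D) R := \d_([tuple]).
exists P; split=> [|f f0 mf].
  by rewrite integral0_eq// => s _; rewrite tuple0.
rewrite [leLHS]integral0_eq ?muln0 ?mul0e// => s _.
by rewrite big_ord0.
Qed.

End random_walk.

(** * Weighted least squares *)

Section reconstruction.
Context {d} {D : measurableType d} {R : realType} {mu : {measure set D -> \bar R}}.
Context {n : nat} (phi : 'I_n -> L2fun mu) (m : nat).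
Hypotheses (n0 : (0 < n)%N) (phi_on : orthonormalL2 phi).
Local Notation v := (frame phi).

(* For m = 4n and good x, the sum over i of wt v x i *: v (x_i) (v (x_i))^*. *)
Definition gram (x : m.-tuple D) : 'M[R[i]]_n := walk v x + ((2 * n)%:R)%:M.

(** The weighted normal equations, solved when [gram x] is invertible. The left factor depends on
    [x] alone, so linearity in [z] holds for every [x]. *)
Definition ls_coef (x : m.-tuple D) (z : 'rV[R[i]]_m) : 'cV[R[i]]_n :=
  invmx (gram x) *m \sum_i ((wt v x i)%:C%C * z 0 i) *: v (tnth x i).

Definition ls_rec (x : m.-tuple D) (z : 'rV[R[i]]_m) : L2 mu :=
  \sum_j ls_coef x z j 0 *: L2class (phi j).

Lemma ls_coef_linear x : linear (ls_coef x).
Proof.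
move=> c z1 z2; rewrite /ls_coef scalemxAr -mulmxDr; congr (_ *m _).
rewrite scaler_sumr -big_split; apply: eq_bigr => i _ /=.
by rewrite !mxE scalerA -scalerDl; congr (_ *: _); ring.
Qed.

Lemma ls_rec_linear x : linear (ls_rec x).
Proof.
move=> c z1 z2; rewrite /ls_rec scaler_sumr -big_split; apply: eq_bigr => j _ /=.
by rewrite ls_coef_linear !mxE scalerA -scalerDl.
Qed.

HB.instance Definition _ x := GRing.isLinear.Build R[i] 'rV[R[i]]_m (L2 mu) *:%R
  (ls_rec x) (ls_rec_linear x).

(** Values enter only multiplied by their weights. The hypothesis is a vanishing product because
    this is what a zero expected weighted sum provides almost surely. *)
Lemma ls_coef_ext x (f g : L2fun mu) :
  (forall i, wt v x i * Normc.normc (f (tnth x i) - g (tnth x i)) = 0) ->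
  ls_coef x (point_values x f) = ls_coef x (point_values x g).
Proof.
move=> fg; congr (_ *m _); apply: eq_bigr => i _; rewrite !mxE; congr (_ *: _).
move/eqP: (fg i); rewrite mulf_eq0 => /orP[/eqP ->|/eqP/Normc.eq0_normc/eqP].
  by rewrite !mul0r.
by rewrite subr_eq0 => /eqP ->.
Qed.

Lemma measurable_ls_coef (f : L2fun mu) :
  mxmeasurable (fun x => ls_coef x (point_values x f)).
Proof.
have mv := mxmeasurable_frame phi.
apply: mxmeasurable_mul.
  apply: mxmeasurable_inv; apply: mxmeasurableD; last exact: mxmeasurable_cst.
  exact: mxmeasurable_walk.
move=> j l; under eq_fun do rewrite summxE.
apply: cmeasurable_sum => i; under eq_fun do rewrite !mxE.
have mt : measurable_fun [set: m.-tuple D] (@tnth m D ^~ i) by exact: measurable_tnth.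
apply: cmeasurableM; last first.
  by apply: cmeasurable_conj; exact: (cmeasurable_comp (L2fun_cmeasurable (phi j)) mt).
apply: cmeasurableM; last exact: (cmeasurable_comp (L2fun_cmeasurable f) mt).
by apply: cmeasurable_real; exact: measurable_wt.
Qed.

(** In the orthonormal basis, the squared distance from the fit to the projection of [f]. *)
Definition coef_error (f : L2fun mu) (x : m.-tuple D) : R :=
  \sum_j Normc.normc (dot (phi j) f - ls_coef x (point_values x f) j 0) ^+ 2.

Lemma measurable_coef_error f : measurable_fun [set: m.-tuple D] (coef_error f).
Proof.
apply: measurable_sum => j; apply: measurable_funX; apply: cmeasurable_normc.
apply: cmeasurableD; first exact: cmeasurable_cst.
by apply: cmeasurableN; exact: measurable_ls_coef.
Qed.

Lemma sqr_norm_ls_rec f x :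
  `|L2class f - ls_rec x (point_values x f)| ^+ 2 =
  `|L2class (residual phi f)| ^+ 2 + coef_error f x.
Proof. by rewrite /ls_rec L2class_sub_comb pythagoras. Qed.

(** The fit reproduces elements of the span exactly, so its error is the fit to the residual, to
    which [weighted_least_squares] applies with [c = 2n]. *)
Lemma coef_error_le f (x : m.-tuple D) : m = (4 * n)%N -> good v x ->
  (2 * n)%:R * coef_error f x <=
  \sum_i wt v x i * Normc.normc (residual phi f (tnth x i)) ^+ 2.
Proof.
move=> mE gx; have [pM _] := good_walk n0 gx.
have GE : gram x = \sum_i (wt v x i)%:C%C *: (v (tnth x i) *m (v (tnth x i))^t*).
  (* The [2n] in [gram] and the starting [2n] of the walk together offset the [m = 4n] unit
     shifts. *)
  apply: (addrI ((2 * n)%:R)%:M); rewrite -walkE// /gram addrCA; congr (_ + _).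
  by rewrite -raddfD /= -natrD mE -mulnDl.
pose al : 'cV[R[i]]_n := \col_j dot (phi j) f.
have pG : pdmx (gram x).
  have c0 : 0 < (2 * n)%:R :> R[i] by rewrite ltr0n muln_gt0.
  apply: pdmxD pM _; split; first by rewrite trmxC_scalar rmorph_nat.
  by move=> u u0; rewrite -scalemx1 qformZ mulr_gt0 ?qform1_gt0.
have Gal : gram x *m al = \sum_i ((wt v x i)%:C%C *
    (\sum_j dot (phi j) f *: phi j : L2fun mu) (tnth x i)) *: v (tnth x i).
  rewrite GE mulmx_suml; apply: eq_bigr => i _; rewrite -scalemxAl -scalerA.
  congr (_ *: _); rewrite -mulmxA eval_span.
  by rewrite [in LHS](mx11_scalar (_ *m al)) mul_mx_scalar.
have Gy : gram x *m (ls_coef x (point_values x f) - al) =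
    \sum_i ((wt v x i)%:C%C * residual phi f (tnth x i)) *: v (tnth x i).
  rewrite mulmxBr mulKVmx ?pdmx_unit// Gal -sumrB; apply: eq_bigr => i _.
  rewrite -scalerBl -mulrBr; congr ((_ * _) *: _).
  by rewrite mxE.
have w0 i : 0 <= (wt v x i)%:C%C :> R[i] by rewrite lecR wt_ge0.
have yE (y : 'cV[R[i]]_n) j : (y - al) j 0 = y j 0 - dot (phi j) f by rewrite !mxE.
have := weighted_least_squares w0 pM GE Gy.
rewrite qform1 -lecR rmorphM rmorph_nat /= !rmorph_sum /=.
congr (_ * _ <= _); apply: eq_bigr => i _.
  by rewrite yE distrC normr_normc rmorphXn.
by rewrite normr_normc rmorphM rmorphXn.
Qed.

End reconstruction.

(** * The sampling theorem and the bound by Kolmogorov widths *)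

Section sampling_theorem.
Context {d} {D : measurableType d} {R : realType} {mu : {measure set D -> \bar R}}.

Lemma integral_eq0_ae d' (T : measurableType d') (P : {measure set T -> \bar R})
    (F : T -> R) : (forall x, 0 <= F x) -> measurable_fun [set: T] F ->
  (\int[P]_x (F x)%:E = 0)%E -> \forall x \ae P, F x = 0.
Proof.
move=> F0 mF I0; have := ae_eq_integral_abs P measurableT (f := EFin \o F).
move=> /(_ (measurableT_comp _ _)) [||+ _]//.
under eq_integral do rewrite /= ger0_norm//.
by move=> /(_ I0); apply: filterS => x /= /(_ Logic.I) [].
Qed.

(** The probability space is the space of histories and [X] is the identity. Linearity of [Rec] is
    kept for the sampling numbers. *)
Lemma least_squares_sampling n (V : set (L2 mu)) :
  (0 < n)%N -> subspace_of_dim n V ->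
  exists (P : probability ((4 * n).-tuple D) R)
    (X : {RV P >-> (4 * n).-tuple D})
    (Rec : (4 * n).-tuple D -> {linear 'rV[R[i]]_(4 * n) -> L2 mu}),
  [/\ forall x z, V (Rec x z), well_posed X Rec &
    forall f : L2fun mu, exists2 u, best_approximation V (L2class f) u &
      ('E_P[sqr_error X Rec f] <= 5%:E * (`|L2class f - u| ^+ 2)%:E)%E].
Proof.
move=> n0 /exists_orthonormal[phi phi_on VE].
have mv := mxmeasurable_frame phi.
have [P [bad0 wb]] := exists_walk n0 phi_on (4 * n).
pose T := ((4 * n).-tuple D)%type.
have mT : measurable_fun [set: T] (fun x : T => x) by exact: measurable_id.
pose X : {RV P >-> T} := mfun_Sub (mem_set mT).
pose Rec x : {linear 'rV[R[i]]_(4 * n) -> L2 mu} := ls_rec phi x.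
have errE f w : sqr_error X Rec f w =
    `|L2class (residual phi f)| ^+ 2 + coef_error phi f w.
  by rewrite -sqr_norm_ls_rec.
have merr f : measurable_fun [set: T] (sqr_error X Rec f).
  rewrite (_ : sqr_error X Rec f =
    fun w => `|L2class (residual phi f)| ^+ 2 + coef_error phi f w).
    by apply: measurable_funD; [exact: measurable_cst|exact: measurable_coef_error].
  by apply/funext => w; exact: errE.
have msum (f : D -> R) : measurable_fun [set: D] f ->
    measurable_fun [set: T] (fun s => \sum_i wt (frame phi) s i * f (tnth s i)).
  move=> mf; apply: measurable_sum => i; apply: measurable_funM.
    exact: measurable_wt.
  by apply: (measurableT_comp mf); exact: measurable_tnth.
have sum_ge0 (f : D -> R) (s : T) : (forall x, 0 <= f x) ->
    0 <= \sum_i wt (frame phi) s i * f (tnth s i).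
  by move=> f0; apply: sumr_ge0 => i _; rewrite mulr_ge0// wt_ge0.
have gae : \forall s \ae P, good (frame phi) (s : (4 * n).-tuple D).
  pose F (s : T) : R := if good (frame phi) s then 0 else 1.
  have F0 s : 0 <= F s by rewrite /F; case: ifP.
  have mF : measurable_fun [set: T] F.
    by apply: measurable_fun_ifT => //; exact: measurable_good.
  apply: filterS (integral_eq0_ae F0 mF bad0) => s; rewrite /F.
  by case: ifP => // _ /eqP; rewrite oner_eq0.
exists P, X, Rec; split.
- by move=> x z; rewrite VE; exists (fun j => ls_coef phi x z j 0).
- split=> // f g fg.
  (* [h] has integral 0, so the expected weighted sum of its values is 0, and almost surely each
     weighted value is 0. *)
  pose h x := Normc.normc (f x - g x).
  have h0 x : 0 <= h x by exact: normc_ge0.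
  have mh : measurable_fun [set: D] h.
    apply: cmeasurable_normc; apply: cmeasurableD; first exact: L2fun_cmeasurable.
    by apply: cmeasurableN; exact: L2fun_cmeasurable.
  have Ih : (\int[mu]_x (h x)%:E = 0)%E.
    rewrite (ge0_ae_eq_integral (g := cst 0%E))//= ?integral0//.
    - exact/measurable_EFinP.
    - by move=> x _; rewrite lee_fin.
    - apply: filterS fg => x /= fg xT; rewrite /h fg// subrr.
      by rewrite Normc.normc0.
  have W0 : (\int[P]_s (\sum_i wt (frame phi) s i * h (tnth s i))%:E = 0)%E.
    apply/eqP; rewrite eq_le; apply/andP; split.
      by rewrite (le_trans (wb h h0 mh))// Ih mule0.
    by apply: integral_ge0 => s _; rewrite lee_fin sum_ge0.
  have := integral_eq0_ae (fun s => sum_ge0 h s h0) (msum h mh) W0.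
  apply: filterS => s /eqP; rewrite psumr_eq0; last first.
    by move=> i _; rewrite mulr_ge0// wt_ge0.
  move=> /allP hs.
  change (ls_rec phi s (point_values s f) = ls_rec phi s (point_values s g)).
  rewrite /ls_rec (@ls_coef_ext _ _ _ _ _ phi _ s f g)// => i.
  by apply/eqP; exact: hs (mem_index_enum _).
move=> f; have [best resE] := best_approximation_residual phi_on f VE.
eexists; first exact: best.
rewrite resE; set r := residual phi f.
pose h x := Normc.normc (r x) ^+ 2.
have h0 x : 0 <= h x by exact: sqr_ge0.
have mh : measurable_fun [set: D] h.
  by apply: measurable_funX; apply: cmeasurable_normc; exact: L2fun_cmeasurable.
have n2 : 0 < (2 * n)%:R :> R by rewrite ltr0n muln_gt0.
set e := `|L2class r| ^+ 2; have e0 : 0 <= e by exact: sqr_ge0.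
pose W (s : T) := \sum_i wt (frame phi) s i * h (tnth s i).
rewrite unlock.
(* The bound on [coef_error] holds on good histories, that is, almost surely. *)
apply: (@le_trans _ _ (\int[P]_s (e%:E + (2 * n)%:R^-1%:E * (W s)%:E))%E).
  apply: ae_ge0_le_integral => //.
  - by move=> s _; rewrite lee_fin sqr_ge0.
  - by apply/measurable_EFinP; exact: merr.
  - move=> s _; rewrite -EFinM -EFinD lee_fin addr_ge0// mulr_ge0 ?invr_ge0 ?(ltW n2)//.
    exact: sum_ge0.
  - apply: emeasurable_funD; first exact: measurable_cst.
    by apply: measurable_funeM; apply/measurable_EFinP; exact: (msum h mh).
  apply: filterS gae => s gs _; rewrite -EFinM -EFinD lee_fin errE lerD2l.
  by rewrite mulrC ler_pdivlMr// mulrC coef_error_le.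
rewrite ge0_integralD//=; last 2 first.
- move=> s _; rewrite -EFinM lee_fin mulr_ge0 ?invr_ge0 ?(ltW n2)//; exact: sum_ge0.
- by apply: measurable_funeM; apply/measurable_EFinP; exact: (msum h mh).
have -> : (\int[P]_s e%:E = e%:E)%E.
  rewrite integral_cst// -[RHS]mule1; congr (_ * _)%E; exact: probability_setT.
rewrite ge0_integralZl//=; last 2 first.
- by apply/measurable_EFinP; exact: (msum h mh).
- by move=> s _; rewrite lee_fin sum_ge0.
have := wb h h0 mh; rewrite -sqr_normL2 -/e => wbh.
(* The [4n] draws contribute [2 * 4n / (2n) = 4], and the distance to [V] contributes 1. *)
apply: (@le_trans _ _ (e%:E + (2 * n)%:R^-1%:E * ((2 * (4 * n))%:R%:E * e%:E))%E).
  by rewrite leeD2l// lee_wpmul2l// lee_fin invr_ge0 ltW.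
rewrite -!EFinM -EFinD lee_fin le_eqVlt; apply/orP; left; apply/eqP.
rewrite mulnCA natrM; field.
by rewrite pnatr_eq0 -lt0n.
Qed.

End sampling_theorem.

Theorem corollary1 (R : realType) :
  exists C K : R, [/\ 1 <= C, 1 <= K &
    forall (d : measure_display) (D : measurableType d)
      (mu : {measure set D -> \bar R}) (n : nat), (1 <= n)%N ->
    (forall V : set (L2 mu), subspace_of_dim n V ->
      exists m : nat, m%:R <= C * n%:R /\
      exists (d' : measure_display) (Omega : measurableType d')
        (P : probability Omega R) (X : {RV P >-> m.-tuple D})
        (Rec : m.-tuple D -> 'rV[R[i]]_m -> L2 mu),
      [/\ forall x z, V (Rec x z),
          well_posed X Rec &
          forall f : L2fun mu,
            exists2 v, best_approximation V (L2class f) v &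
              ('E_P[sqr_error X Rec f] <=
                 K%:E * (`|L2class f - v| ^+ 2)%:E)%E])
    /\
    (forall A : set (L2 mu), compact A ->
      (rand_sampling_number (Num.truncn (C * n%:R)) A <=
         K%:E * kolmogorov_width n A)%E)].
Proof.
exists 4, 5; split; [by rewrite ler1n..|] => d D mu n n0; split=> [V dimV|A _].
  exists (4 * n)%N; split; first by rewrite natrM.
  have [P [X [Rec [RecV wp err]]]] := least_squares_sampling n0 dimV.
  by exists _, _, P, X, (fun x z => Rec x z).
have -> : Num.truncn (4 * n%:R : R) = (4 * n)%N by rewrite -natrM natrK.
(* The constant is moved to the left only while the infimum over [V] is opened. *)
rewrite -lee_pdivrMl//; apply: le_ereal_inf_tmp => _ [V dimV <-] /=.
set s := Defs.sup0 _; rewrite lee_pdivrMl//.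
have [P [X [Rec [RecV wp err]]]] := least_squares_sampling n0 dimV.
have s0 : (0 <= s)%E by rewrite /s /Defs.sup0 le_max lexx.
have s50 : (0 <= 5%:E * s)%E by rewrite mule_ge0.
(* Here [5 s^2] is relaxed to [(5 s)^2], so that the same constant serves after the square root. *)
have errs f : A (L2class f) -> ('E_P[sqr_error X Rec f] <= (5%:E * s) ^+ 2)%E.
  move=> Af; have [u [Vu ubest] uerr] := err f; apply: le_trans uerr _.
  have us : (`|L2class f - u|%:E <= s)%E.
    rewrite /s /Defs.sup0 le_max; apply/orP; right.
    apply: le_trans (ereal_sup_ubound _); last by exists (L2class f).
    by apply: le_ereal_inf_tmp => _ [w Vw <-]; rewrite lee_fin ubest.
  have r0 : 0 <= `|L2class f - u| := normr_ge0 _.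
  (* An infinite [s] makes the bound trivial. *)
  move: us r0 s0; move: `|_| => r; case: s {s50} => [s||] //; last first.
    by move=> _ _ _; rewrite mulry gtr0_sg// mul1e expe2 mulyy leey.
  rewrite -!EFinM -EFin_expe !lee_fin => rs r0 s0.
  by have := ler_pM r0 r0 rs rs; nra.
rewrite -[leRHS]gee0_abs// -sqrte_sqr lee_sqrt ?expe_ge0//.
apply: le_trans (ereal_inf_lbound _) _.
  by exists _, _, P, X, Rec; split; [exact: wp|reflexivity].
rewrite /Defs.sup0 ge_max expe_ge0//=; apply: ge_ereal_sup => _ [f /= Af <-].
exact: errs.
Qed.
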